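(* Let $k$ be a field and let $\mathfrak{F}:\mathbb{P}^2\dashrightarrow\mathbb{P}^2$ be a rational map over $k$ whose base ideal scheme is a codimension $2$ locally complete intersection. Then $\mathfrak{F}$ is a Cremona map if and only if it is defined by the $2\times 2$ minors of a $3\times 2$ matrix of linear forms.
   Context: $k$ is of arbitrary characteristic. A rational map $\mathbb{P}^2\dashrightarrow\mathbb{P}^2$ is given by three forms $f_0,f_1,f_2\in k[X_0,X_1,X_2]$ of the same degree; its base ideal is $I=(f_0,f_1,f_2)$. The hypothesis means that $I$ has codimension (height) $2$ and that $I$ is locally a complete intersection at its minimal primes (i.e. $I_P$ is generated by a regular sequence for each minimal prime $P$ of $I$). A Cremona map is a birational map of $\mathbb{P}^2$ onto itself. *)

(* Defs.v *)
From mathcomp Require Import all_boot all_order all_algebra fraction.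
From mathcomp Require Import boolp classical_sets.
From mathcomp Require Import mpoly.

Set Implicit Arguments.
Unset Strict Implicit.
Unset Printing Implicit Defensive.

Import GRing.Theory.
Local Open Scope classical_set_scope.
Local Open Scope ring_scope.

(* Ideals are sets in the classical sense: the ideals of [ring_quotient] are
   boolean predicates, i.e. decidable ideals. *)
Definition prime_ideal (R : comNzRingType) (P : set R) : Prop :=
  [/\ P 0, ~ P 1,
      forall a x y, P x -> P y -> P (a * x + y)
    & forall x y, P (x * y) -> P x \/ P y].

Definition minimal_prime (R : comNzRingType) (I P : set R) : Prop :=
  [/\ prime_ideal P, I `<=` P
    & forall Q, prime_ideal Q -> I `<=` Q -> Q `<=` P -> P `<=` Q].

Definition prime_chain (R : comNzRingType) (P : set R) (n : nat) : Prop :=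
  exists C : nat -> set R,
    [/\ forall i, (i <= n)%N -> prime_ideal (C i),
        forall i, (i < n)%N -> C i `<` C i.+1
      & C n = P].

(* A chain can be shortened from below, so [prime_chain P n] says that the
   height of the prime [P] is at least [n]. The height of [I] is the minimum of
   the heights of the primes containing [I]. *)
Definition has_height (R : comNzRingType) (I : set R) (n : nat) : Prop :=
  (forall P, prime_ideal P -> I `<=` P -> prime_chain P n) /\
  (exists P, [/\ prime_ideal P, I `<=` P & ~ prime_chain P n.+1]).

Section RegularSequences.
Variables (A : comNzRingType) (S : set A).

(* The ideal generated by [g] in the subring [S] of [A]. *)
Definition ideal_span (g : seq A) : set A :=
  [set x | exists c : nat -> A,
     (forall i, S (c i)) /\ x = \sum_(i < size g) c i * g`_i].

(* Regular sequences of the subring [S] of [A]. *)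
Definition regular_sequence (g : seq A) : Prop :=
  [/\ forall x, x \in g -> S x,
      ~ ideal_span g 1
    & forall i, (i < size g)%N -> forall x, S x ->
        ideal_span (take i g) (g`_i * x) -> ideal_span (take i g) x].

End RegularSequences.

(* The localization of [I] at the prime [P], as a subset of the field of
   fractions; [localize P setT] is the local ring at [P]. *)
Definition localize (R : idomainType) (P I : set R) : set {fraction R} :=
  [set x | exists a s : R, [/\ I a, ~ P s & x = tofrac a / tofrac s]].

Definition locally_ci_at_minimal_primes (R : idomainType) (I : set R) : Prop :=
  forall P, minimal_prime I P ->
    exists g : seq {fraction R},
      regular_sequence (localize P setT) g /\
      ideal_span (localize P setT) g = localize P I.

Record rational_map (k : fieldType) := RationalMap {
  map_degree : nat;
  forms : 3.-tuple {mpoly k[3]};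
  forms_homog : forall i, tnth forms i \is map_degree.-homog;
  forms_neq0 : exists i, tnth forms i != 0
}.

Definition base_ideal (k : fieldType) (F : rational_map k) :
    set {mpoly k[3]} :=
  [set x | exists c : 'I_3 -> {mpoly k[3]},
     x = \sum_(i < 3) c i * tnth (forms F) i].

(* The composite [G o F] is defined (its forms do not all vanish) and, as a
   rational map, it is the identity (X_0 : X_1 : X_2). *)
Definition comp_is_id (k : fieldType) (G F : rational_map k) : Prop :=
  let h i := tnth (forms G) i \mPo forms F in
  (exists i, h i != 0) /\
  (forall i j : 'I_3, h i * 'X_j = h j * 'X_i).

Definition is_cremona (k : fieldType) (F : rational_map k) : Prop :=
  exists G : rational_map k, comp_is_id G F /\ comp_is_id F G.

(* The defining forms of [F] are compared with the minors up to a nonzero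
   constant, not up to a common factor: (X_0 : X_1 : 0) is not birational, but
   its multiples (l X_0 : l X_1 : 0), l a linear form, are the minors of a
   linear 3 x 2 matrix. Unsigned minors suffice: negating the middle row of [M]
   turns (m0, m1, m2) into -(m0, - m1, m2). *)
Definition defined_by_minors (k : fieldType) (F : rational_map k)
    (M : 'M[{mpoly k[3]}]_(3, 2)) : Prop :=
  exists2 c : k, c != 0 &
    forall i, tnth (forms F) i = c *: \det (row' i M : 'M_2).

(* Main.v *)
From HB Require Import structures.
Require Import Defs.
From mathcomp Require Import all_boot all_order all_algebra fraction.
From mathcomp Require Import boolp classical_sets.
From mathcomp Require Import mpoly.
From mathcomp Require Import ring zify.

Set Implicit Arguments.
Unset Strict Implicit.
Unset Printing Implicit Defensive.

Import GRing.Theory.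
Local Open Scope ring_scope.

(** Let [f] be the triple of forms of [F] and [I] the base ideal. Where [I] is a
    complete intersection, its symmetric algebra is its Rees algebra. Hence a
    form [H(x, y)] in [y] which vanishes at [y = f(x)] is, up to torsion at the
    irrelevant ideal, a combination of the linear equations [s(x) . y = 0] given
    by the syzygies [s] of [f]. Over a fixed point [y] there is no torsion: the
    values [s(x) . y] form the ideal [(f0', f1') : f2'], for the forms [f'] in
    coordinates with [y = (0 : 0 : 1)], and such an ideal is saturated.

    If [G] is an inverse of [F], take [H = x_i G_j(y) - x_j G_i(y)] and [y]
    generic: there are two independent linear syzygies. Their cross product is
    a multiple of [f], and this leaves the degree 2 only (in degree 1 the base
    ideal would be irrelevant).

    Conversely, write the two columns of a linear matrix as [s(x) . y = x . n(y)]
    and let [G] be the cross product of the two vectors [n]. It inverts [F] as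
    soon as [G(f)] is nonzero. Otherwise a quadratic form [H(y)] vanishes at
    [f]; then the values [s(x) . y] at the generic [y] generate the unit ideal,
    so [f] has a constant syzygy, which is absurd. *)

(** * Factorial rings *)

(** Two devices replace dimension theory. Points of the base locus are handled by primes [P] over
    [I], homogeneous or not, that meet [k[X_t]] only in 0 for a chosen variable. For coprime [a],
    [b] in [I] every polynomial is algebraic over [k[X_t]] modulo [(a, b)], so each element of [P]
    is nilpotent modulo [(a, b)] after localization at [P]. Hence [P] is minimal over [I], and the
    hypothesis on [I_P] applies. That hypothesis gives a regular sequence of unknown length. Three
    or more generators would make [(a, b)] saturated at [P], against nilpotency; so two of the three
    forms generate [I_P]. An equation [H] then becomes a polynomial in one ratio of forms, and
    Gauss's lemma splits off its linear factor. This is why factoriality of polynomial rings comes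
    first. The multipliers that carry [H(Y)] into the syzygy ideal thus meet every [k[X_t]], and the
    grading turns this into powers of the variables, which saturation removes. All this happens over
    the field [K] of the generic point; the relations return to [k] because kernels of matrices
    commute with field extension. *)

Section Factoriality.
Variable R : idomainType.
Implicit Types (a b c p x y : R) (s : seq R).

Definition divides a b : Prop := exists c, b = a * c.

Definition prime_elt p : Prop :=
  [/\ p != 0, p \isn't a GRing.unit
    & forall x y, divides p (x * y) -> divides p x \/ divides p y].

Definition factorial_ring : Prop := forall x, x != 0 ->
  exists s u, [/\ u \is a GRing.unit, forall p, p \in s -> prime_elt p
                & x = u * \prod_(p <- s) p].

Definition no_common_prime a b : Prop :=
  forall p, prime_elt p -> divides p a -> divides p b -> False.

Lemma divides_refl a : divides a a.
Proof. by exists 1; rewrite mulr1. Qed.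

Lemma divides_trans b a c : divides a b -> divides b c -> divides a c.
Proof. by move=> [x ->] [y ->]; exists (x * y); rewrite mulrA. Qed.

Lemma divides_mulr a b c : divides a b -> divides a (b * c).
Proof. by move=> [x ->]; exists (x * c); rewrite mulrA. Qed.

Lemma divides_mull a b c : divides a b -> divides a (c * b).
Proof. by rewrite mulrC; apply: divides_mulr. Qed.

Lemma dividesD a b c : divides a b -> divides a c -> divides a (b + c).
Proof. by move=> [x ->] [y ->]; exists (x + y); rewrite mulrDr. Qed.

Lemma dividesBl a b c : divides a (b + c) -> divides a b -> divides a c.
Proof.
by move=> [x e] [y ey]; exists (x - y); rewrite mulrBr -e -ey addrC addKr.
Qed.

Lemma divides0 a : divides a 0.
Proof. by exists 0; rewrite mulr0. Qed.

Lemma prime_elt_not_unit p u :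
  prime_elt p -> u \is a GRing.unit -> ~ divides p u.
Proof.
move=> [_ /negP pU _] uU [c e]; apply: pU.
by move: uU; rewrite e unitrM => /andP[].
Qed.

Lemma prime_elt_prod p s :
  prime_elt p -> divides p (\prod_(q <- s) q) ->
  exists2 q, q \in s & divides p q.
Proof.
move=> pP; elim: s => [|q s IH].
  by rewrite big_nil => /(prime_elt_not_unit pP (unitr1 _)).
rewrite big_cons; have [_ _ pM] := pP => /pM [pq|/IH [r rs pr]].
  by exists q; rewrite ?mem_head.
by exists r => //; rewrite in_cons rs orbT.
Qed.

Lemma prime_elt_assoc p q : prime_elt p -> prime_elt q ->
  divides p q -> divides q p.
Proof.
move=> [p0 pU pM] [q0 qU qM] [c e].
have /qM[//|[d ed]] : divides q (p * c) by rewrite -e; apply: divides_refl.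
case/negP: pU; apply/unitrPr; exists d; apply: (mulfI q0).
by rewrite mulrCA -ed -e mulr1.
Qed.

(** Induction on the prime factors of [b]: each divides [a * x] but not [a], hence divides [x], and
    is cancelled on both sides. *)
Lemma coprime_divides a b x y : factorial_ring -> b != 0 ->
  no_common_prime a b -> a * x = b * y -> divides b x.
Proof.
move=> fR /fR [s [u [uU]]].
elim: s b u uU x y => [|p s IH] b u uU x y sP ->.
  move=> _ _; rewrite big_nil mulr1; exists (u^-1 * x).
  by rewrite mulVKr.
rewrite big_cons => cop e.
have pP := sP p (mem_head _ _).
have [p0 _ pM] := pP.
have pb : divides p (u * (p * \prod_(q <- s) q)).
  by exists (u * \prod_(q <- s) q); ring.
have : divides p (a * x) by rewrite e; apply: divides_mulr.
case/pM => [pa|[x' ex]]; first by case: (cop p).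
have [|||z ez] := IH _ u uU x' y _ erefl.
- by move=> q qs; apply: sP; rewrite in_cons qs orbT.
- move=> q qP qa qb; apply: (cop q qP qa).
  by rewrite mulrCA; apply: divides_mull.
- apply: (mulfI p0); rewrite mulrCA -ex e; ring.
by exists z; rewrite ex ez; ring.
Qed.

Lemma gcd_split a b : factorial_ring -> a != 0 ->
  exists g a' b', [/\ a = g * a', b = g * b' & no_common_prime a' b'].
Proof.
move=> fR /fR [s [u [uU]]].
elim: s a b u uU => [|p s IH] a b u uU sP ea.
  exists 1, a, b; rewrite !mul1r; split=> // q qP; rewrite ea big_nil mulr1.
  by move=> /(prime_elt_not_unit qP uU).
have [|g [a' [b' [e1 e2 cop]]]] := IH (u * \prod_(q <- s) q) b u uU _ erefl.
  by move=> q qs; apply: sP; rewrite in_cons qs orbT.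
have pP := sP p (mem_head _ _); have [p0 _ pM] := pP.
move: ea; rewrite big_cons mulrCA e1 => ea.
have [[b1 eb1]|npb] := pselect (divides p b').
  exists (g * p), a', b1; rewrite ea e2 eb1; split; [ring|ring|].
  move=> q qP qa qb; apply: (cop q qP qa); rewrite eb1; exact: divides_mull.
exists g, (p * a'), b'; rewrite ea e2; split; [ring|by []|].
move=> q qP; have [_ _ qM] := qP => /qM [qp|qa] qb; last exact: (cop q).
by apply: npb; apply: divides_trans qb; apply: prime_elt_assoc.
Qed.

(** The relations between two elements form a free module of rank one, generated by the pair left
    after removing the gcd. The saturation argument rests on this freeness. *)
Lemma relations_free a b : factorial_ring -> (a != 0) || (b != 0) ->
  exists a' b', [/\ a * b' = b * a', (a' != 0) || (b' != 0) &
    forall x y, a * x = b * y -> exists w, x = w * b' /\ y = w * a'].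
Proof.
move=> fR.
wlog a0 : a b / a != 0 => [H /orP[a0|b0]|_].
- by apply: H => //; rewrite a0.
- have [|b' [a' [e1 nz e2]]] := H b a b0; first by rewrite b0.
  exists a', b'; rewrite orbC; split=> // x y e.
  by have [w [-> ->]] := e2 _ _ (esym e); exists w.
have [g [a' [b' [ea eb cop]]]] := gcd_split b fR a0.
have /andP[g0 a'0] : (g != 0) && (a' != 0) by rewrite -negb_or -mulf_eq0 -ea.
exists a', b'; split; [by rewrite ea eb; ring|by rewrite a'0|].
move=> x y; rewrite ea eb -!mulrA => /(mulfI g0) e.
have cop' : no_common_prime b' a' by move=> p pP ? ?; apply: (cop p).
have [w ew] := coprime_divides fR a'0 cop' (esym e).
exists w; split; last by rewrite ew mulrC.
by apply: (mulfI a'0); rewrite e ew; ring.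
Qed.

Lemma prime_of_nonunit a : factorial_ring -> a != 0 ->
  a \isn't a GRing.unit -> exists2 p, prime_elt p & divides p a.
Proof.
move=> fR /fR [[|p s] [u [uU sP ->]]].
  by rewrite big_nil mulr1 uU.
move=> _; exists p; first by apply: sP; rewrite mem_head.
by exists (u * \prod_(q <- s) q); rewrite big_cons; ring.
Qed.

(** Prime avoidance: [t] is the product of the prime factors of [a] that do not divide [b]. Every
    prime factor of [a] then divides exactly one of [b] and [t * c]. *)
Lemma coprime_shift a b c : factorial_ring -> a != 0 ->
  (forall p, prime_elt p -> divides p a -> divides p b -> divides p c -> False) ->
  exists t, no_common_prime a (b + t * c).
Proof.
move=> fR /fR [s [u [uU sP ->]]] cop.
pose t := \prod_(q <- [seq q <- s | ~~ `[< divides q b >]]) q.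
have us p : prime_elt p -> divides p (u * \prod_(q <- s) q) ->
    exists2 q, q \in s & divides p q /\ divides q p.
  move=> pP; have [_ _ pM] := pP => /pM [/(prime_elt_not_unit pP uU)//|].
  case/(prime_elt_prod pP) => q qs pq; exists q => //; split=> //.
  by apply: prime_elt_assoc => //; apply: sP.
exists t => p pP pa pbtc.
have [q qs [pq qp]] := us p pP pa; have qP := sP q qs.
have qa : divides q (u * \prod_(q <- s) q) by apply: divides_trans pa.
have qbtc : divides q (b + t * c) by apply: divides_trans pbtc.
have [_ _ qM] := qP.
have [qb|nqb] := pselect (divides q b).
  have /qM[] := dividesBl qbtc qb; last exact: (cop q qP qa qb).
  case/(prime_elt_prod qP) => r; rewrite mem_filter => /andP[/asboolP nrb rs].
  by move=> /(prime_elt_assoc qP (sP r rs)) rq; apply/nrb/(divides_trans rq).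
apply: (nqb); move: qbtc; rewrite addrC => /dividesBl; apply.
apply: divides_mulr; rewrite /t (big_rem q) /=; first exact/divides_mulr/divides_refl.
by rewrite mem_filter qs andbT; apply/asboolPn.
Qed.

End Factoriality.

(** * Gauss's lemma and factoriality in one variable *)

Section GaussLemma.
Variable R : idomainType.
Hypothesis fR : factorial_ring R.
Implicit Types (p c : R) (f g h : {poly R}).

Lemma divides_polyC p f : divides p%:P f <-> forall i, divides p f`_i.
Proof.
split=> [[g ->] i|H]; first by exists g`_i; rewrite coefCM.
have [g gP] := choice H; exists (\poly_(i < size f) g i).
apply/polyP=> i; rewrite coefCM coef_poly; case: ltnP => [//|/leq_sizeP fi].
by rewrite mulr0 fi.
Qed.

(** Let [i] and [j] be the lowest indices of coefficients of [f] and [g] not divisible by [p]. In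
    the coefficient of index [i + j] of the product, every term but one is divisible by [p]. *)
Lemma prime_elt_polyC p : prime_elt p -> prime_elt p%:P.
Proof.
move=> [p0 pU pM]; split; first by rewrite polyC_eq0.
  by apply: contra pU; rewrite poly_unitE coefC eqxx => /andP[].
move=> f g /divides_polyC pfg.
have [|nf] := pselect (forall i, divides p f`_i); first by move/divides_polyC; left.
have [|ng] := pselect (forall i, divides p g`_i); first by move/divides_polyC; right.
have first_bad h : ~ (forall i, divides p h`_i) ->
    exists i, ~ divides p h`_i /\ forall j, (j < i)%N -> divides p h`_j.
  move=> nh.
  have ex : exists i, ~~ `[< divides p h`_i >].
    by apply: contrapT => H; apply: nh => i; apply: contrapT => H1; apply: H;
      exists i; apply/asboolPn.
  case: (ex_minnP ex) => i /asboolPn ni mi; exists i; split=> // j ji.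
  by apply: contrapT => /asboolPn /mi; rewrite leqNgt ji.
have [i [fi fj]] := first_bad f nf; have [j [gj gk]] := first_bad g ng.
have := pfg (i + j)%N; rewrite coefM.
have ilt : (i < (i + j).+1)%N by rewrite ltnS leq_addr.
rewrite (bigD1 (Ordinal ilt)) //= addKn addrC => /dividesBl [].
  elim/big_ind: _ => [|x y|[l /= lt] nl]; [exact: divides0|exact: dividesD|].
  have : l != i by rewrite -(inj_eq val_inj) in nl.
  rewrite neq_ltn => /orP[li|il]; first by apply: divides_mulr; apply: fj.
  apply: divides_mull; apply: gk.
  rewrite -(ltn_add2r l) subnK; last exact: lt.
  by rewrite addnC ltn_add2l.
by move=> x ex; case: (pM f`_i g`_j) => //; exists x.
Qed.

Definition primitive f : Prop := forall p, prime_elt p -> ~ divides p%:P f.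

(** A prime constant dividing [f] divides its leading coefficient. The induction is on a list of
    primes whose product that coefficient divides, and each extracted prime shortens the list. *)
Lemma primitive_part f : f != 0 ->
  exists c g, [/\ c != 0, f = c%:P * g & primitive g].
Proof.
move=> f0; have lf0 : lead_coef f != 0 by rewrite lead_coef_eq0.
have [s [u [uU sP e]]] := fR lf0.
have {e lf0} : divides (lead_coef f) (\prod_(p <- s) p).
  by exists u^-1; rewrite e mulrC mulKr.
have [n] := ubnP (size s); elim: n f s {u uU} f0 sP => // n IH f s f0 sP sn ds.
have [|] := pselect (primitive f).
  by exists 1, f; rewrite mul1r oner_neq0.
rewrite /primitive; move/existsNP => [q /not_implyP [qP /contrapT [g eg]]].
have [q0 _ _] := qP.
have g0 : g != 0 by apply: contraNneq f0 => g0; rewrite eg g0 mulr0.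
have lf : lead_coef f = q * lead_coef g by rewrite eg lead_coefM lead_coefC.
have [r rs [y ey]] : exists2 r, r \in s & divides q r.
  apply: (prime_elt_prod qP); apply: divides_trans ds; rewrite lf.
  exact/divides_mulr/divides_refl.
have [|x ex] := prime_elt_assoc qP (sP r rs); first by exists y.
have yx : y * x = 1 by apply: (mulfI q0); rewrite mulrA -ey -ex mulr1.
have [|||c [h [c0 eh hP]]] := IH g (rem r s) g0.
- by move=> p /mem_rem; apply: sP.
- by rewrite size_rem //; case: (s) sn rs.
- case: ds => z; rewrite (big_rem r) //= ey lf -!mulrA => /(mulfI q0) ez.
  exists (z * x); rewrite mulrA -ez mulrAC yx mul1r //.
exists (q * c), h; split=> //; first by rewrite mulf_neq0.
by rewrite eg eh polyCM mulrA.
Qed.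

Lemma primitive_divides c f g :
  c != 0 -> primitive f -> divides f (c%:P * g) -> divides f g.
Proof.
move=> c0 fP; have [s [u [uU sP ->]]] := fR c0.
elim: s g sP => [|p s IH] g sP.
  rewrite big_nil mulr1 => -[h e]; exists (u^-1%:P * h).
  by rewrite mulrCA -e mulrA -polyCM mulVr // mul1r.
rewrite big_cons mulrCA polyCM -mulrA => -[h e].
have pP := sP p (mem_head _ _); have [p0 _ _] := pP.
apply: IH => [q qs|]; first by apply: sP; rewrite in_cons qs orbT.
have [_ _ pM] := prime_elt_polyC pP.
have [|/(fP p pP)//|[h' eh]] := pM f h; first by rewrite -e;
  exists ((u * \prod_(q <- s) q)%:P * g).
have pC0 : p%:P != 0 by rewrite polyC_eq0.
by exists h'; apply: (mulfI pC0); rewrite e eh; ring.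
Qed.

(** [dvdp] over a domain is divisibility up to a nonzero constant; when the divisor is primitive,
    the primes of this constant can be cancelled. *)
Lemma primitive_dvdp f g :
  primitive f -> Pdiv.Idomain.dvdp f g -> divides f g.
Proof.
move=> fP /Pdiv.Idomain.dvdpP [[c q] /= c0 e].
by apply: (primitive_divides c0 fP); exists q; rewrite mul_polyC e mulrC.
Qed.

Lemma divides_dvdp f g : divides f g -> Pdiv.Idomain.dvdp f g.
Proof.
case=> h e; apply/Pdiv.Idomain.dvdpP; exists (1, h); rewrite ?oner_neq0 //=.
by rewrite scale1r e mulrC.
Qed.

Lemma primitive_divisor f g : primitive f -> divides g f -> primitive g.
Proof. by move=> fP gf p pP pg; apply: (fP p pP); apply: divides_trans gf. Qed.

(** If [f] is not prime, it divides some [g * g'] without dividing a factor. Its gcd with [g] is not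
    constant, or else [f] would divide [g']; the cofactor is not constant, or else [f] would divide
    [g]. The primitive part of the gcd and its cofactor are thus both of smaller degree. *)
Lemma primitive_factorization f : f != 0 -> primitive f ->
  exists (s : seq {poly R}) (u : {poly R}),
    [/\ u \is a GRing.unit, forall p : {poly R}, p \in s -> prime_elt p
      & f = u * \prod_(p <- s) p].
Proof.
have [n] := ubnP (size f); elim: n f => // n IH f fn f0 fP.
have fU : size f = 1%N -> f \is a GRing.unit.
  move=> f1; have f1' := eq_leq f1; rewrite (size1_polyC f1').
  have c0 : f`_0 != 0 by rewrite -polyC_eq0 -(size1_polyC f1').
  apply: contrapT => nU; have /(prime_of_nonunit fR c0) [p pP [x ex]] : f`_0
    \isn't a GRing.unit.
    apply/negP=> h; apply: nU; rewrite poly_unitE size_polyC c0 coefC eqxx //.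
  apply: (fP p pP); exists x%:P; rewrite -polyCM -ex; exact: size1_polyC.
have [f1|f1] := eqVneq (size f) 1%N.
  by exists [::], f; rewrite big_nil mulr1; split=> //; apply: fU.
have fnU : f \isn't a GRing.unit by apply: contra f1; rewrite poly_unitE => /andP[].
have [fPr|nPr] := pselect (prime_elt f).
  exists [:: f], 1; rewrite big_seq1 mul1r unitr1; split=> // p.
  by rewrite inE => /eqP ->.
have [g [g' [fgg nfg nfg']]] :
    exists g g', [/\ divides f (g * g'), ~ divides f g & ~ divides f g'].
  apply: contrapT => H; apply: nPr; split=> // g g' fgg.
  apply: contrapT => /not_orP [nfg nfg']; apply: H; by exists g, g'.
have ncop : ~~ Pdiv.Idomain.coprimep f g.
  apply/negP=> cop; apply: nfg'; apply: primitive_dvdp => //.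
  by rewrite -(Pdiv.Idomain.Gauss_dvdpr _ cop); apply: divides_dvdp.
pose h := Pdiv.Idomain.gcdp f g.
have hf : Pdiv.Idomain.dvdp h f by apply: Pdiv.Idomain.dvdp_gcdl.
have h0 : h != 0 by apply: contraNneq f0 => h0; rewrite h0 in hf;
  rewrite -(Pdiv.Idomain.dvd0p f).
have h1 : (1 < size h)%N.
  by move: ncop; rewrite Pdiv.Idomain.coprimep_def ltn_neqAle eq_sym lt0n
    size_poly_eq0 h0 andbT.
have [c [h' [c0 eh hP]]] := primitive_part h0.
have sh : size h' = size h by rewrite eh size_Cmul.
have h'h : Pdiv.Idomain.dvdp h' h by apply: divides_dvdp; exists c%:P; rewrite mulrC.
have [q eq] : divides h' f by apply: primitive_dvdp => //;
  apply: Pdiv.Idomain.dvdp_trans hf.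
have /andP[h'0 q0] : (h' != 0) && (q != 0) by rewrite -negb_or -mulf_eq0 -eq.
have qP : primitive q by apply: (primitive_divisor fP); exists h'; rewrite mulrC.
have sq : (1 < size q)%N.
  rewrite ltnNge; apply/negP=> q1; apply: nfg; apply: primitive_dvdp => //.
  apply: (Pdiv.Idomain.dvdp_trans _ (Pdiv.Idomain.dvdp_gcdr f g)); rewrite -/h.
  have ql := size1_polyC q1.
  have qc0 : q`_0 != 0 by rewrite -polyC_eq0 -ql.
  apply/Pdiv.Idomain.dvdpP; exists (q`_0, c%:P) => //=.
  by rewrite eh eq {2}ql -mul_polyC; ring.
have sf : size f = (size h' + size q).-1 by rewrite eq size_mul.
rewrite -sh in h1.
have [|s1 [u1 [u1U s1P e1]]] := IH h' _ h'0 hP.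
  by lia.
have [|s2 [u2 [u2U s2P e2]]] := IH q _ q0 qP.
  by lia.
exists (s1 ++ s2), (u1 * u2); split; first by rewrite unitrM u1U.
  by move=> p; rewrite mem_cat => /orP[/s1P|/s2P].
by rewrite big_cat /= eq e1 e2; ring.
Qed.

Lemma factorial_poly : factorial_ring {poly R}.
Proof.
move=> f f0; have [c [g [c0 e gP]]] := primitive_part f0.
have g0 : g != 0 by apply: contraNneq f0 => g0; rewrite e g0 mulr0.
have [s1 [u1 [u1U s1P e1]]] := fR c0.
have [s2 [u2 [u2U s2P e2]]] := primitive_factorization g0 gP.
exists ([seq p%:P | p <- s1] ++ s2), (u1%:P * u2); split.
- by rewrite unitrM u2U andbT; apply: rmorph_unit.
- move=> p; rewrite mem_cat => /orP[/mapP[q /s1P qP ->]|/s2P//].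
  exact: prime_elt_polyC.
- rewrite big_cat big_map /= e e1 e2 rmorphM rmorph_prod /=; ring.
Qed.

End GaussLemma.

Lemma factorial_field (k : fieldType) : factorial_ring k.
Proof.
by move=> x x0; exists [::], x; rewrite big_nil mulr1 unitfE.
Qed.

Lemma factorial_transfer (R S : idomainType) (f : {rmorphism R -> S}) (g : S -> R) :
  cancel f g -> cancel g f -> factorial_ring S -> factorial_ring R.
Proof.
move=> fK gK fS x x0.
have fI := can_inj fK.
have f0 y : (f y == 0) = (y == 0) by rewrite -(rmorph0 f) (inj_eq fI).
have gM y z : g (y * z) = g y * g z by apply: fI; rewrite rmorphM !gK.
have g1 : g 1 = 1 by apply: fI; rewrite gK rmorph1.
have gU y : y \is a GRing.unit -> g y \is a GRing.unit.
  by move=> yU; apply/unitrPr; exists (g y^-1); rewrite -gM mulrV.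
have [|s [u [uU sP e]]] := fS (f x); first by rewrite f0.
exists (map g s), (g u); split; first exact: gU.
  move=> _ /mapP[p /sP [p0 pU pM] ->]; split.
  - by rewrite -f0 gK.
  - by apply: contra pU => /(rmorph_unit f); rewrite gK.
  - move=> y z [w ew].
    have [|[v ev]|[v ev]] := pM (f y) (f z).
    + by exists (f w); rewrite -rmorphM ew rmorphM gK.
    + by left; exists (g v); rewrite -gM -ev fK.
    + by right; exists (g v); rewrite -gM -ev fK.
apply: fI; rewrite e rmorphM gK big_map rmorph_prod; congr (_ * _).
by apply: eq_bigr => i _; rewrite gK.
Qed.

(** * Factoriality in several variables, by adjoining them one at a time *)

Section MpolyFactorial.
Variable k : fieldType.

Lemma muni_monomial n (m : 'X_{1..n.+1}) :
  muni 'X_[k, m] =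
  'X_[[multinom m (widen_ord (leqnSn n) i) | i < n]] *: 'X^(m ord_max).
Proof. by rewrite muniE msuppX big_seq1 mcoeffX eqxx scale1r. Qed.

Lemma muni_mwiden n (p : {mpoly k[n]}) : muni (mwiden p) = p%:P.
Proof.
pose F : {additive {mpoly k[n]} -> {poly {mpoly k[n]}}} := (@muni n k \o
  @mwiden n k)%FUN.
rewrite -[muni _]/(F p) [p]mpolyE !raddf_sum; apply: eq_bigr => m _ /=.
rewrite mwidenZ mwidenX muniZ muni_monomial mnmwiden_ordmax expr0.
rewrite -mul_mpolyC polyCM -!mul_polyC mulr1; congr (_ * ('X_[ _])%:P).
by apply/mnmP => i; rewrite mnmE mnmwiden_widen.
Qed.

Definition mpoly_of_poly n : {poly {mpoly k[n]}} -> {mpoly k[n.+1]} :=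
  horner_eval 'X_ord_max \o map_poly (@mwiden n k).

Lemma muniK n : cancel (@muni n k) (@mpoly_of_poly n).
Proof.
move=> p; rewrite muniE [in RHS](mpolyE p) /mpoly_of_poly raddf_sum /=.
apply: eq_bigr => m _; rewrite -mul_polyC rmorphM /=.
rewrite map_polyC map_polyXn /horner_eval /= hornerM hornerC hornerXn.
rewrite mwidenZ mwidenX -scalerAl; congr (_ *: _).
rewrite mpolyXn -mpolyXD; congr 'X_[_]; apply/mnmP => i.
rewrite !mnmE; case: (unliftP ord_max i) => [j ->|->].
  have -> : lift ord_max j = widen_ord (leqnSn n) j.
    by apply: val_inj; rewrite /= /bump leqNgt ltn_ord add0n.
  rewrite mnmwiden_widen mnmE mulmnE mnm1E -(inj_eq val_inj) /=.
  by rewrite gtn_eqF ?ltn_ord // mul0n addn0.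
by rewrite mnmwiden_ordmax mulmnE mnm1E eqxx mul1n.
Qed.

Lemma mpoly_of_polyK n : cancel (@mpoly_of_poly n) (@muni n k).
Proof.
move=> q; rewrite -[in RHS](coefK q) poly_def /mpoly_of_poly /= /horner_eval.
rewrite horner_coef size_map_inj_poly; [|exact: inj_mwiden|exact: mwiden0].
rewrite raddf_sum /=; apply: eq_bigr => i _.
rewrite coef_map muniM muni_mwiden -mul_polyC rmorphXn /=; congr (_ * _ ^+ _).
rewrite muni_monomial mnmE eqxx expr1.
rewrite (_ : [multinom _ | _ < _] = 0%MM) ?mpolyX0 ?scale1r //.
apply/mnmP => j; rewrite !mnmE -(inj_eq val_inj) /= gtn_eqF //.
Qed.

Lemma factorial_mpoly n : factorial_ring {mpoly k[n]}.
Proof.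
elim: n => [|n IH].
  apply: (@factorial_transfer _ _ (mcoeff 0%MM : {rmorphism {mpoly k[0]} -> k})
    (@mpolyC 0 k)).
  - by move=> p; rewrite -nvar0_mpolyC.
  - exact: mpolyCK.
  - exact: factorial_field.
apply: (factorial_transfer (@muniK n) (@mpoly_of_polyK n)).
exact: factorial_poly.
Qed.

End MpolyFactorial.

(** * Depth and dimension *)

Section LinearCombination.
Variable A : comNzRingType.
Implicit Types x y c l r : A.

Lemma lincomb1 c1 l1 r1 x y : l1 = r1 -> x - y = c1 * (l1 - r1) -> x = y.
Proof. by move=> -> /eqP; rewrite subrr mulr0 subr_eq0 => /eqP. Qed.

Lemma lincomb2 c1 c2 l1 r1 l2 r2 x y : l1 = r1 -> l2 = r2 ->
  x - y = c1 * (l1 - r1) + c2 * (l2 - r2) -> x = y.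
Proof. by move=> -> -> /eqP; rewrite !subrr !mulr0 addr0 subr_eq0 => /eqP. Qed.

Lemma lincomb3 c1 c2 c3 l1 r1 l2 r2 l3 r3 x y : l1 = r1 -> l2 = r2 -> l3 = r3 ->
  x - y = c1 * (l1 - r1) + c2 * (l2 - r2) + c3 * (l3 - r3) -> x = y.
Proof. by move=> -> -> -> /eqP; rewrite !subrr !mulr0 !addr0 subr_eq0 => /eqP. Qed.

End LinearCombination.
Arguments lincomb1 {A} c1 {l1 r1 x y}.
Arguments lincomb2 {A} c1 c2 {l1 r1 l2 r2 x y}.
Arguments lincomb3 {A} c1 c2 c3 {l1 r1 l2 r2 l3 r3 x y}.

(** * Saturation of ideals with two generators *)

Section Saturation.
Variables (A : idomainType) (S : set A).
Hypotheses (SB : forall x y, S x -> S y -> S (x - y))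
           (SM : forall x y, S x -> S y -> S (x * y)).

Definition span2 (a b u : A) : Prop :=
  exists p q, [/\ S p, S q & u = a * p + b * q].

Let SN x : S x -> S (- x).
Proof. by move=> Sx; rewrite -sub0r; apply: SB => //; rewrite -(subrr x);
  apply: SB. Qed.

Let SD x y : S x -> S y -> S (x + y).
Proof. by move=> Sx Sy; rewrite -[y]opprK; apply: SB => //; apply: SN. Qed.

(* A torsion class [u] of A/(a, b) maps injectively to the second Koszul
   cohomology, with respect to [z1, z2, z3], of the module of relations of [a]
   and [b]; as this module is free, that group vanishes. *)
Lemma span2_saturated (z1 z2 z3 a b a' b' u : A) :
  S z1 -> S z2 -> S z3 -> z1 != 0 ->
  (forall x y, S x -> S y -> z2 * x = z1 * y -> exists2 w, S w & x = z1 * w) ->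
  (forall x, S x -> span2 z1 z2 (z3 * x) -> span2 z1 z2 x) ->
  S a' -> S b' -> a * b' = b * a' -> (a' != 0) || (b' != 0) ->
  (forall x y, S x -> S y -> a * x = b * y ->
     exists w, [/\ S w, x = w * b' & y = w * a']) ->
  S u -> span2 a b (z1 * u) -> span2 a b (z2 * u) -> span2 a b (z3 * u) ->
  span2 a b u.
Proof.
move=> Sz1 Sz2 Sz3 z10 reg2 reg3 Sa' Sb' e0 nz rel Su.
move=> [p1 [q1 [Sp1 Sq1 e1]]] [p2 [q2 [Sp2 Sq2 e2]]] [p3 [q3 [Sp3 Sq3 e3]]].
have R zi zj pi pj qi qj : S zi -> S zj -> S pi -> S pj -> S qi -> S qj ->
    zi * u = a * pi + b * qi -> zj * u = a * pj + b * qj ->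
    exists w, [/\ S w, zj * pi - zi * pj = w * b' & zi * qj - zj * qi = w * a'].
  move=> Szi Szj Spi Spj Sqi Sqj ei ej.
  apply: rel; [by apply: SB; apply: SM|by apply: SB; apply: SM|].
  by apply: (lincomb2 zi (- zj) ej ei); ring.
have [w12 [Sw12 e12p e12q]] := R z1 z2 p1 p2 q1 q2 Sz1 Sz2 Sp1 Sp2 Sq1 Sq2 e1 e2.
have [w13 [Sw13 e13p e13q]] := R z1 z3 p1 p3 q1 q3 Sz1 Sz3 Sp1 Sp3 Sq1 Sq3 e1 e3.
have [w23 [Sw23 e23p e23q]] := R z2 z3 p2 p3 q2 q3 Sz2 Sz3 Sp2 Sp3 Sq2 Sq3 e2 e3.
(* The alternating sum of the three relations vanishes after multiplication by [a'] and by [b'], one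
   of which can be cancelled. *)
have cocycle : z3 * w12 = z1 * (- w23) + z2 * w13.
  have [n0|n0] := orP nz; apply: (mulIf n0).
    by apply: (lincomb3 (- z3) z2 (- z1) e12q e13q e23q); ring.
  by apply: (lincomb3 (- z3) z2 (- z1) e12p e13p e23p); ring.
(* By regularity of [z3], [w12] is a coboundary [z1 * v1 + z2 * v2]. Correcting the first two pairs
   of coefficients by multiples of [(b', - a')] leaves their values unchanged and makes them
   proportional to [(z1, z2)], so that [z1] divides the first pair. *)
have [|v1 [v2 [Sv1 Sv2 ew]]] := reg3 w12 Sw12.
  by exists (- w23), w13; split=> //; apply: SN.
have [|||p Sp ep] := reg2 (p1 - v2 * b') (p2 + v1 * b').
- by apply: SB => //; apply: SM.
- by apply: SD => //; apply: SM.
- by apply: (lincomb2 1 b' e12p ew); ring.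
have [|||q Sq eq] := reg2 (q1 + v2 * a') (q2 - v1 * a').
- by apply: SD => //; apply: SM.
- by apply: SB => //; apply: SM.
- by apply: (lincomb2 (- 1) (- a') e12q ew); ring.
exists p, q; split=> //; apply: (mulfI z10).
rewrite e1; apply: (lincomb3 a b v2 ep eq e0); ring.
Qed.

Lemma span2Ml a b c u : S c -> span2 a b u -> span2 a b (c * u).
Proof.
move=> Sc [p [q [Sp Sq ->]]]; exists (c * p), (c * q).
by split; [exact: SM|exact: SM|ring].
Qed.

Lemma span2D a b u v : span2 a b u -> span2 a b v -> span2 a b (u + v).
Proof.
move=> [p [q [Sp Sq ->]]] [p' [q' [Sp' Sq' ->]]].
by exists (p + p'), (q + q'); split; [exact: SD|exact: SD|ring].
Qed.

End Saturation.

(** Induction on the sum of the exponents: multiplying [u] by one of the [z] lowers one exponent and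
    keeps the other two. *)
Lemma saturated_powers (A : comNzRingType) (J : set A) (z1 z2 z3 : A) :
  (forall c u, J u -> J (c * u)) ->
  (forall u, J (z1 * u) -> J (z2 * u) -> J (z3 * u) -> J u) ->
  forall n1 n2 n3 u, J (z1 ^+ n1 * u) -> J (z2 ^+ n2 * u) -> J (z3 ^+ n3 * u) ->
  J u.
Proof.
move=> JM sat n1 n2 n3; have [n] := ubnP (n1 + n2 + n3)%N.
elim: n n1 n2 n3 => // n IH [|n1] [|n2] [|n3] nn u J1 J2 J3;
  rewrite ?expr0 ?mul1r // in J1 J2 J3 *.
have step i m v : J (i ^+ m.+1 * v) -> J (i ^+ m * (i * v)) by rewrite exprSr mulrA.
have mul i m z v : J (i ^+ m * v) -> J (i ^+ m * (z * v)) by rewrite mulrCA; apply: JM.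
apply: sat.
- by apply: (IH n1 n2.+1 n3.+1); [lia|exact: step|exact: mul|exact: mul].
- by apply: (IH n1.+1 n2 n3.+1); [lia|exact: mul|exact: step|exact: mul].
- by apply: (IH n1.+1 n2.+1 n3); [lia|exact: mul|exact: mul|exact: step].
Qed.

(** * Counting monomials *)

Lemma mpoly_dependent (k : fieldType) n d (S : finType) (v : S -> {mpoly k[n]}) :
  (forall s, msize (v s) <= d)%N -> (#|{: 'X_{1..n < d}}| < #|S|)%N ->
  exists l : S -> k, (exists s, l s != 0) /\ \sum_s l s *: v s = 0.
Proof.
move=> vd card.
pose A : 'M_(#|S|, #|{: 'X_{1..n < d}}|) :=
  \matrix_(i, j) (v (enum_val i))@_(enum_val j : 'X_{1..n < d}).
have : kermx A != 0.
  by rewrite kermx_eq0 -row_leq_rank -ltnNge (leq_ltn_trans (rank_leq_col A)).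
case/rowV0Pn => u /sub_kermxP uA u0.
have [j uj] : exists j, u 0 j != 0.
  apply: contrapT => H; case/eqP: u0; apply/rowP => j; rewrite mxE.
  by apply/eqP; apply: contrapT => /negP uj; apply: H; exists j.
exists (fun s => u 0 (enum_rank s)); split.
  by exists (enum_val j); rewrite enum_valK.
apply/mpolyP => m; rewrite mcoeff0 raddf_sum /=.
have [md|md] := ltnP (mdeg m) d; last first.
  rewrite big1 // => s _; rewrite mcoeffZ memN_msupp_eq0 ?mulr0 //.
  by apply: msize_mdeg_ge; apply: leq_trans md.
have := congr1 (fun B : 'M_(_, _) => B 0 (enum_rank (BMultinom md))) uA.
rewrite !mxE => e; rewrite -[RHS]e (reindex (@enum_val S predT)) /=; last first.
  by exists enum_rank => x _; rewrite ?enum_valK ?enum_rankK.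
by apply: eq_bigr => i _; rewrite mcoeffZ enum_valK mxE enum_rankK.
Qed.

Section MonomialCount.
Variables (n d : nat) (p : 'X_{1..n}).

Lemma mshift_proof (m : 'X_{1..n < d - mdeg p}) : (mdeg (m + p)%MM < d)%N.
Proof. by rewrite mdegD; have := bmdeg m; lia. Qed.

Lemma card_multiples :
  #|[set m : 'X_{1..n < d} | (p <= m)%MM]| = #|{: 'X_{1..n < d - mdeg p}}|.
Proof.
pose g m := BMultinom (mshift_proof m).
have gI : injective g.
  move=> m1 m2 /(congr1 val) /= /(congr1 (fun m => m - p)%MM).
  by rewrite !addmK => e; apply: val_inj.
rewrite -(card_imset _ gI); apply: eq_card => m; rewrite inE.
apply/idP/imsetP => [pm|[m' _ ->]]; last exact: lem_addl.
have lt : (mdeg (m - p)%MM < d - mdeg p)%N.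
  have := bmdeg m; rewrite -{1}(submK pm) mdegD; lia.
by exists (BMultinom lt) => //; apply: val_inj; rewrite /= submK.
Qed.

End MonomialCount.

(** Inclusion and exclusion for the monomials divisible by [X_0 ^ p1] or by [X_1 ^ p2]. Those
    divisible by neither have two bounded exponents, so their number is linear in [d]; the bound on
    it is rough. *)
Lemma card_monomials_le d p1 p2 c (N := #|{: 'X_{1..3 < d}}|)
    (N1 := #|{: 'X_{1..3 < d - p1}}|) (N2 := #|{: 'X_{1..3 < d - p2}}|)
    (N12 := #|{: 'X_{1..3 < d - p1 - p2}}|) :
  c = (p1.+1 * p2.+1 * d.+1)%N -> (N + N12 <= N1 + N2 + c)%N.
Proof.
move=> ->.
pose m1 : 'X_{1..3} := (U_(0%R) *+ p1)%MM; pose m2 : 'X_{1..3} := (U_(1%R) *+ p2)%MM.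
have dm1 : mdeg m1 = p1 by rewrite mdegMn mdeg1 mul1n.
have dm2 : mdeg m2 = p2 by rewrite mdegMn mdeg1 mul1n.
pose S1 := [set m : 'X_{1..3 < d} | (m1 <= m)%MM].
pose S2 := [set m : 'X_{1..3 < d} | (m2 <= m)%MM].
have e1 : #|S1| = N1 by rewrite card_multiples dm1.
have e2 : #|S2| = N2 by rewrite card_multiples dm2.
have le1 (m : 'X_{1..3}) : (m1 <= m)%MM = (p1 <= m 0%R)%N.
  apply/mnm_lepP/idP => [/(_ 0%R)|h i]; first by rewrite mulmnE mnm1E eqxx mul1n.
  by rewrite mulmnE mnm1E; case: eqP => [<-|]; rewrite ?mul1n ?mul0n.
have le2 (m : 'X_{1..3}) : (m2 <= m)%MM = (p2 <= m 1%R)%N.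
  apply/mnm_lepP/idP => [/(_ 1%R)|h i]; first by rewrite mulmnE mnm1E eqxx mul1n.
  by rewrite mulmnE mnm1E; case: eqP => [<-|]; rewrite ?mul1n ?mul0n.
have le12 (m : 'X_{1..3}) : ((m1 + m2)%MM <= m)%MM = (p1 <= m 0%R)%N && (p2 <= m 1%R)%N.
  rewrite -le1 -le2; apply/mnm_lepP/andP => [h|[/mnm_lepP h1 /mnm_lepP h2] i].
    by split; apply/mnm_lepP => i; apply: leq_trans (h i);
      rewrite mnmDE ?leq_addr ?leq_addl.
  have := h1 i; have := h2 i; rewrite mnmDE !mulmnE !mnm1E.
  case: eqP => [<-|]; case: eqP => [//|]; lia.
have e12 : #|S1 :&: S2| = N12.
  rewrite /N12 -subnDA -dm1 -dm2 -mdegD -card_multiples; apply: eq_card => m.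
  by rewrite !inE le12 le1 le2.
have eC : (#|~: (S1 :|: S2)| <= p1.+1 * p2.+1 * d.+1)%N.
  have lt0 (m : 'X_{1..3 < d}) : m \in ~: (S1 :|: S2) -> (m 0%R < p1)%N /\ (m
    1%R < p2)%N.
    by rewrite !inE le1 le2 negb_or -!ltnNge => /andP.
  have lt2 (m : 'X_{1..3 < d}) : ((m : 'X_{1..3}) 2%:R < d)%N.
    by apply: leq_ltn_trans (bmdeg m); rewrite mdegE (bigD1 2%:R) //= leq_addr.
  pose g (m : 'X_{1..3 < d}) : 'I_p1.+1 * 'I_p2.+1 * 'I_d.+1 :=
    (inord ((m : 'X_{1..3}) 0%R), inord ((m : 'X_{1..3}) 1%R), inord ((m :
      'X_{1..3}) 2%:R)).
  have -> : (p1.+1 * p2.+1 * d.+1)%N = #|{: 'I_p1.+1 * 'I_p2.+1 * 'I_d.+1}|.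
    by rewrite !card_prod !card_ord.
  have gI : {in ~: (S1 :|: S2) &, injective g}.
    move=> m m' /lt0[a b] /lt0[a' b'] [] /(congr1 val) /= e3 /(congr1 val) /=
      e4 /(congr1 val) /= e5.
    apply: val_inj; apply/mnmP => i.
    move: e3 e4 e5; rewrite !inordK ?ltnS ?(ltnW a) ?(ltnW b) ?(ltnW a') ?(ltnW
      b') ?(ltnW (lt2 _)) //.
    move=> e3 e4 e5; case: i => -[|[|[|//]]] ?; [move: e3|move: e4|move: e5];
    by move=> e; apply: etrans (etrans e _); congr (fun_of_multinom _ _);
      apply: val_inj.
  by rewrite -(card_in_imset gI) max_card.
have := cardsC (S1 :|: S2); have := cardsUI S1 S2.
rewrite e1 e2 e12 -/N; move: eC; set x := #|~: _|; set y := #|_ :|: _|.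
lia.
Qed.

(** The embedding of [k[X_t]]. If a prime meets its image only in 0, the quotient has positive
    dimension. *)
Definition at_var (k : fieldType) n (t : 'I_n) : {poly k} -> {mpoly k[n]} :=
  horner_eval 'X_t \o map_poly (@mpolyC n k).

HB.instance Definition _ (k : fieldType) n (t : 'I_n) :=
  GRing.RMorphism.copy (@at_var k n t) (horner_eval 'X_t \o map_poly (@mpolyC n k)).

Lemma at_varXn (k : fieldType) n (t : 'I_n) u :
  at_var t 'X^u = 'X_t ^+ u :> {mpoly k[n]}.
Proof. by rewrite /at_var /= map_polyXn /horner_eval hornerXn. Qed.

Lemma at_varE (k : fieldType) n (t : 'I_n) (c : {poly k}) :
  at_var t c = \sum_(i < size c) c`_i *: 'X_t ^+ i.
Proof.
rewrite -[in LHS](coefK c) poly_def rmorph_sum /=; apply: eq_bigr => i _.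
by rewrite -mul_polyC rmorphM /= at_varXn /at_var /= map_polyC /horner_eval
  hornerC mul_mpolyC.
Qed.

Lemma msize_exp_le (k : fieldType) n (f : {mpoly k[n]}) i :
  (msize (f ^+ i) <= (msize f).-1 * i + 1)%N.
Proof.
have [->|f0] := eqVneq f 0.
  by case: i => [|i]; rewrite ?expr0 ?msize1 ?addn1 // expr0n msize0.
elim: i => [|i IH]; first by rewrite expr0 msize1 muln0.
rewrite exprS msizeM ?expf_neq0 // mulnS; move: IH (mpolySpred mdeg f0).
by move: (msize (f ^+ i)) (msize f) (_ * i)%N => x y z; lia.
Qed.

Section AlgebraicModulo.
Variables (k : fieldType) (a b f : {mpoly k[3]}) (t : 'I_3).
Hypotheses (a0 : a != 0) (b0 : b != 0)
  (rel : forall x y, a * x = b * y -> divides b x).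

(* Modulo a regular sequence [a, b], the quotient of k[X_0, X_1, X_2] has
   dimension 1, so that [f] is algebraic over k[X_t]. The dimension count works
   with the space of polynomials of degree less than [d]; a complement of the
   relations [(b w, - a w)] is given by the [x] without any monomial divisible
   by [mlead b]. *)
Lemma algebraic_modulo : exists D (c : 'I_D -> {poly k}),
  (exists i, c i != 0) /\ span2 setT a b (\sum_i at_var t (c i) * f ^+ i).
Proof.
pose da := (msize a).-1; pose db := (msize b).-1; pose e := (msize f).-1.
have ea : msize a = da.+1 by apply: mpolySpred.
have eb : msize b = db.+1 by apply: mpolySpred.
(* [C * d.+1] bounds the error of the monomial count, while the products [X_t ^ u * f ^ i] number
   [D * L]. As [D] exceeds [2 * C] and [d] is large against [e * D], the products outnumber the
   error, although [L] loses [e * D] to keep all degrees below [d]. *)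
pose C := (da.+1 * db.+1)%N; pose D := (2 * C).+1.
pose d := (2 * C * (e * D) + da + db + C + 1)%N; pose L := (d - e * D)%N.
pose T1 := {m : 'X_{1..3 < d - da} | ~~ (mlead b <= m)%MM}.
pose T2 := 'X_{1..3 < d - db}; pose T3 := ('I_D * 'I_L)%type.
pose v (s : T1 + (T2 + T3)) : {mpoly k[3]} := match s with
  | inl m => 'X_[val m] * a
  | inr (inl m) => 'X_[m] * b
  | inr (inr iu) => 'X_t ^+ iu.2 * f ^+ iu.1 end.
have X0 m : 'X_[m] != 0 :> {mpoly k[3]} by rewrite -msize_poly_eq0 msizeX.
have vd s : (msize (v s) <= d)%N.
  case: s => [[m /= _]|[m|[i u]]] /=.
  - rewrite msizeM // msizeX ea; have := bmdeg m; lia.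
  - rewrite msizeM // msizeX eb; have := bmdeg m; lia.
  - have [->|f0] := eqVneq (f ^+ i) 0; first by rewrite mulr0 msize0.
    rewrite mpolyXn msizeM ?X0 // msizeX mdegMn mdeg1.
    have := msize_exp_le f i; rewrite -/e.
    have : (e * i <= e * D)%N by rewrite leq_mul2l ltnW ?orbT.
    have := ltn_ord u; rewrite {2}/L mul1n.
    by move: (msize _) (e * i)%N (e * D)%N (nat_of_ord u) => w x y z; lia.
(* The monomials excluded from [T1] are counted by [d - da - db], the last term of the inclusion and
   exclusion formula. What remains to check is [C * d.+1 < D * L]. *)
have card : (#|{: 'X_{1..3 < d}}| < #|{: T1 + (T2 + T3)}|)%N.
  rewrite !card_sum card_prod !card_ord.
  have := card_monomials_le (p1 := da) (p2 := db) (d := d) erefl.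
  have : (#|{: T1}| + #|{: 'X_{1..3 < d - da - db}}| = #|{: 'X_{1..3 < d - da}}|)%N.
    have <- : mdeg (mlead b) = db by apply/eqP; rewrite -eqSS mlead_deg // eb.
    rewrite -card_multiples card_sub addnC -(cardsC [set m : 'X_{1..3 < d - da}
      | (mlead b <= m)%MM]).
    by congr (_ + _)%N; apply: eq_card => m; rewrite !inE.
  rewrite -/C.
  have : (C * d.+1 < D * L)%N.
    have arith c E s : (c.+1 * (2 * c.+1 * E + s.+1).+1
        < (2 * c.+1).+1 * (2 * c.+1 * E + s.+1 - E))%N.
      have -> : (2 * c.+1 * E + s.+1 - E = (2 * c + 1) * E + s.+1)%N by nia.
      have -> : ((2 * c.+1).+1 * ((2 * c + 1) * E + s.+1) =
        (c.+1 * (2 * c.+1 * E + s.+1).+1).+1 + ((2 * c * c + 4 * c + 1) * E +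
          (c + 2) * s))%N.
        by lia.
      exact: leq_addr.
    have := arith C.-1 (e * D)%N (da + db + C)%N.
    by rewrite prednK ?muln_gt0 // /L /D /d !addnS !addn0 !addnA.
  have arith N n1 X N1 N2 x y :
      (x < y -> n1 + X = N1 -> N + X <= N1 + N2 + x -> N < n1 + (N2 + y))%N by lia.
  by move=> h1 h2 h3; apply: arith h1 h2 h3.
have [l [[s0 ls0] lrel]] := mpoly_dependent vd card.
pose x := \sum_(m : T1) l (inl m) *: 'X_[val m] : {mpoly k[3]}.
pose y := \sum_(m : T2) l (inr (inl m)) *: 'X_[m] : {mpoly k[3]}.
pose c i : {poly k} := \poly_(u < L) (if insub u is Some u then l (inr (inr (i,
  u))) else 0).
have cE i : at_var t (c i) = \sum_(u < L) l (inr (inr (i, u))) *: 'X_t ^+ u.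
  rewrite /c poly_def rmorph_sum /=; apply: eq_bigr => u _.
  by rewrite -mul_polyC rmorphM /= at_varXn /at_var /= map_polyC /horner_eval
    hornerC mul_mpolyC valK.
have rel0 : x * a + y * b + \sum_i at_var t (c i) * f ^+ i = 0.
  apply: etrans lrel; rewrite big_sumType /= big_sumType /= -addrA; congr (_ + (_ + _)).
  - by rewrite mulr_suml; apply: eq_bigr => m _; rewrite scalerAl.
  - by rewrite mulr_suml; apply: eq_bigr => m _; rewrite scalerAl.
  - under eq_bigr => i _ do rewrite cE mulr_suml.
    by rewrite pair_big; apply: eq_bigr => -[i u] _; rewrite scalerAl.
exists D, c; split; last first.
  by exists (- x), (- y); split=> //; apply: (lincomb1 1 rel0); ring.
apply: contrapT => c0.
have {c0} c0 i : c i = 0.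
  by apply/eqP; apply: contrapT => /negP ci; apply: c0; exists i.
have xy : x * a + y * b = 0.
  by move: rel0; rewrite big1 ?addr0 // => i _; rewrite c0 rmorph0 mul0r.
have coefx (m : T1) : x@_(val m) = l (inl m).
  rewrite /x raddf_sum (bigD1 m) //= mcoeffZ mcoeffX eqxx mulr1 big1 ?addr0 // => m' ne.
  rewrite mcoeffZ mcoeffX; case: eqP => [emm|]; last by rewrite mulr0.
  by case/eqP: ne; do 2!apply: val_inj.
(* By [rel], [b] divides [x]; the leading monomial of a nonzero [x] would be a multiple of
   [mlead b], and [T1] has none. *)
have x0 : x = 0.
  apply/eqP; apply: contrapT => /negP x0.
  have [|w ew] := rel (x := x) (y := - y); first by apply: (lincomb1 1 xy); ring.
  have w0 : w != 0 by apply: contraNneq x0 => w0; rewrite ew w0 mulr0.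
  have : mlead x \in msupp x by apply: mlead_supp.
  rewrite mcoeff_msupp {2}/x raddf_sum => /eqP; apply; apply: big1 => m _ /=.
  rewrite mcoeffZ mcoeffX; case: eqP => [emm|]; last by rewrite mulr0.
  by have := valP m; rewrite /= emm ew mleadM // lem_addr.
have y0 : y = 0.
  by apply/eqP; move/eqP: xy; rewrite x0 mul0r add0r mulf_eq0 (negbTE b0) orbF.
have coefy (m : T2) : y@_m = l (inr (inl m)).
  rewrite /y raddf_sum (bigD1 m) //= mcoeffZ mcoeffX eqxx mulr1 big1 ?addr0 // => m' ne.
  rewrite mcoeffZ mcoeffX; case: eqP => [emm|]; last by rewrite mulr0.
  by case/eqP: ne; apply: val_inj.
case/eqP: ls0; case: s0 => [m|[m|[i u]]].
- by rewrite -coefx x0 mcoeff0.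
- by rewrite -coefy y0 mcoeff0.
- by have := congr1 (fun p : {poly k} => p`_u) (c0 i);
  rewrite coef_poly ltn_ord valK coef0.
Qed.

End AlgebraicModulo.

(** * Primes over the base ideal *)

Section PrimeIdeals.
Variable R : comNzRingType.
Implicit Types (P J S : set R).

Lemma prime_idealD P x y : prime_ideal P -> P x -> P y -> P (x + y).
Proof. by move=> [_ _ PD _] Px Py; rewrite -[x]mul1r; apply: PD. Qed.

Lemma prime_idealMl P a x : prime_ideal P -> P x -> P (a * x).
Proof. by move=> [P0 _ PD _] Px; rewrite -[a * x]addr0; apply: PD. Qed.

Lemma prime_ideal_sum P (T : finType) (A : pred T) (G : T -> R) :
  prime_ideal P -> (forall i, A i -> P (G i)) -> P (\sum_(i | A i) G i).
Proof.
move=> PP PG; elim/big_ind: _ => //; first by case: PP.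
by move=> x y; apply: prime_idealD.
Qed.

Lemma prime_idealX P x n : prime_ideal P -> P (x ^+ n) -> P x.
Proof.
move=> PP; elim: n => [|n IH]; first by case: PP.
by rewrite exprS; have [_ _ _ PM] := PP => /PM [].
Qed.

Lemma exists_prime_ideal J S :
  J 0 -> (forall a x y, J x -> J y -> J (a * x + y)) ->
  S 1 -> (forall x y, S x -> S y -> S (x * y)) ->
  (forall x, J x -> ~ S x) ->
  exists P, [/\ prime_ideal P, (J `<=` P)%classic & forall x, P x -> ~ S x].
Proof.
move=> J0 JD S1 SM JS.
(* The conditions bear on the union with [J], not on [A], because the empty chain, whose union is
   empty, must satisfy them too. *)
pose Q (A : set R) := (forall a x y, (A `|` J)%classic x -> (A `|` J)%classic y ->
    (A `|` J)%classic (a * x + y)) /\ forall x, (A `|` J)%classic x -> ~ S x.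
have [|A [[AD AS] Amax]] := @Zorn_bigcup R Q.
  move=> F FQ Ftot; split=> [a x y|x].
    move=> [[A FA Ax]|Jx] [[B FB By]|Jy].
    - have [AB|BA] := Ftot A B FA FB.
      + have [BD _] := FQ B FB.
        by case: (BD a x y); [left; apply: AB|left|left; exists B|right].
      + have [AD _] := FQ A FA.
        by case: (AD a x y); [left|left; apply: BA|left; exists A|right].
    - have [AD _] := FQ A FA.
      by case: (AD a x y); [left|right|left; exists A|right].
    - have [BD _] := FQ B FB.
      by case: (BD a x y); [right|left|left; exists B|right].
    - by right; apply: JD.
  move=> [[A FA Ax]|]; last exact: JS.
  by have [_] := FQ A FA; apply; left.
pose P := (A `|` J)%classic; rewrite -/P in AD AS.
have P0 : P 0 by right.
have extend x : ~ P x -> exists p a, P p /\ S (p + a * x).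
  move=> nPx; apply: contrapT => H.
  pose B : set R := [set z | exists p a, P p /\ z = p + a * x]%classic.
  have PB : (P `<=` B)%classic by move=> p Pp; exists p, 0; rewrite mul0r addr0.
  have BE z : (B `|` J)%classic z -> B z.
    by case=> // Jz; apply: PB; right.
  apply: (Amax B); split.
  - by move=> z Az; apply: PB; left.
  - move=> BA; apply: nPx; left; apply: BA.
    by exists 0, 1; rewrite mul1r add0r.
  - move=> c y z /BE [p [a [Pp ->]]] /BE [p' [a' [Pp' ->]]]; left.
    by exists (c * p + p'), (c * a + a'); split; [exact: AD|ring].
  - by move=> z /BE [p [a [Pp ->]]] Sz; apply: H; exists p, a.
exists P; split=> [|x Jx|//]; last by right.
split=> [//|P1|//|x y Pxy]; first exact: AS P1 S1.
apply: contrapT => /not_orP [/extend [p [a [Pp Sp]]] /extend [q [b [Pq Sq]]]].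
apply: AS (SM _ _ Sp Sq).
have PM c z : P z -> P (c * z) by move=> Pz; rewrite -[c * z]addr0; exact: AD.
have -> : (p + a * x) * (q + b * y) =
    q * p + ((a * x) * q + ((a * b) * (x * y) + (b * y) * p)) by ring.
by exact: (AD _ _ _ Pp (AD _ _ _ Pq (AD _ _ _ Pxy (PM _ _ Pp)))).
Qed.

End PrimeIdeals.

Lemma prime_ideal_of_prime_elt (R : idomainType) (p : R) :
  prime_elt p -> prime_ideal [set x | divides p x]%classic.
Proof.
move=> pP; have [p0 pU pM] := pP; split=> /=.
- exact: divides0.
- by move/(prime_elt_not_unit pP (unitr1 _)).
- by move=> a x y px py; apply: dividesD => //; apply: divides_mull.
- exact: pM.
Qed.

Lemma prime_ideal_prime_elt (R : idomainType) (P : set R) x :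
  factorial_ring R -> prime_ideal P -> P x -> x != 0 ->
  exists2 p, prime_elt p & P p /\ divides p x.
Proof.
move=> fR [P0 P1 PD PM] Px /fR [s [u [uU sP e]]]; move: Px; rewrite e => /PM [Pu|].
  by case: P1; rewrite -(mulVr uU) -[_ * _]addr0; apply: PD.
have {sP} : forall p, p \in s -> prime_elt p /\ divides p x.
  move=> p ps; split; first exact: sP.
  by rewrite e (big_rem p) //= mulrCA; apply/divides_mulr/divides_refl.
rewrite -e; elim: s {e} => [|p s IH] sP; first by rewrite big_nil.
rewrite big_cons => /PM [Pp|Ps].
  by have [pP px] := sP p (mem_head _ _); exists p.
by apply: IH => // q qs; apply: sP; rewrite in_cons qs orbT.
Qed.

(** The height bound of Krull in the factorial case: a nonzero prime ideal inside [(p)] contains a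
    prime element, which is associated to [p], so it equals [(p)]. *)
Lemma principal_height_le1 (R : idomainType) (p : R) :
  factorial_ring R -> prime_elt p -> ~ prime_chain [set x | divides p x]%classic 2.
Proof.
move=> fR pP [C [Cp Cl C2]].
have [C01 nC10] := Cl 0 isT; have [] := Cl 1 isT; rewrite C2 => C12 nC21.
have [x C1x nC0x] : exists2 x, C 1%N x & ~ C 0 x.
  apply: contrapT => H; apply: nC10 => x C1x; apply: contrapT => C0x; apply: H;
    by exists x.
have x0 : x != 0 by apply: contra_notN nC0x => /eqP ->; case: (Cp 0 isT).
have [q qP [C1q _]] := prime_ideal_prime_elt fR (Cp 1%N isT) C1x x0.
have [c ec] := prime_elt_assoc pP qP (C12 q C1q).
apply: nC21 => y [d ->]; rewrite mulrC; apply: prime_idealMl; first exact: Cp.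
by rewrite ec mulrC; apply: prime_idealMl; first exact: Cp.
Qed.

Lemma ord3_cases (i j : 'I_3) : [\/ j = i, j = i + 1 | j = i + 1 + 1].
Proof.
have : [|| j == i, j == i + 1 | j == i + 1 + 1].
  by case: i => -[|[|[|//]]] ?; case: j => -[|[|[|//]]] ?.
by case/or3P => /eqP ->; [constructor 1|constructor 2|constructor 3].
Qed.

Lemma sum_ord3 (V : nmodType) (i : 'I_3) (G : 'I_3 -> V) :
  \sum_j G j = G i + (G (i + 1) + G (i + 1 + 1)).
Proof.
have e3 : i + 1 + 1 + 1 = i by apply: val_inj; case: i => -[|[|[|//]]] ?.
rewrite (bigD1 i) // (bigD1 (i + 1)) /=; last by case: i {e3} => -[|[|[|//]]] ?.
rewrite (bigD1 (i + 1 + 1)) /=; last by case: i {e3} => -[|[|[|//]]] ?.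
rewrite big1 ?addr0 // => j /andP[/andP[j0 j1] j2].
by case: (ord3_cases i j) j0 j1 j2 => ->; rewrite eqxx.
Qed.

Section BaseLocus.
Variables (k : fieldType) (F : rational_map k).
Hypothesis codimF : has_height (base_ideal F) 2.

Local Notation R := {mpoly k[3]}.
Local Notation f := (tnth (forms F)).
Local Notation I := (base_ideal F).

Lemma form_in_base i : I (f i).
Proof.
exists (fun j => (j == i)%:R); rewrite (bigD1 i) //= eqxx mul1r big1 ?addr0 //.
by move=> j /negbTE ->; rewrite mul0r.
Qed.

Lemma base_idealD a x y : I x -> I y -> I (a * x + y).
Proof.
move=> [c ->] [d ->]; exists (fun i => a * c i + d i).
rewrite mulr_sumr -big_split /=; apply: eq_bigr => i _.
by rewrite mulrDl mulrA.
Qed.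

Lemma base_ideal_sub (P : set R) :
  prime_ideal P -> (forall i, P (f i)) -> (I `<=` P)%classic.
Proof.
by move=> PP Pf _ [c ->]; apply: prime_ideal_sum => // i _; apply: prime_idealMl.
Qed.

Lemma forms_coprime p : prime_elt p -> ~ forall i, divides p (f i).
Proof.
move=> pP pf; have [H _] := codimF.
have pPI := prime_ideal_of_prime_elt pP.
by apply: (principal_height_le1 (@factorial_mpoly k 3) pP); apply: H => //;
  apply: base_ideal_sub.
Qed.

Lemma unit_notin_base u : u \is a GRing.unit -> ~ I u.
Proof.
move=> uU Iu; have [_ [P [PP IP _]]] := codimF.
have [_ P1 _ _] := PP; apply: P1; rewrite -(mulVr uU).
by apply: prime_idealMl => //; apply: IP.
Qed.

(** A regular sequence of length two in [I]. Height two forbids a common prime factor of the three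
    forms, and prime avoidance combines two of them into a form coprime to the third. *)
Lemma coprime_pair : exists a b, [/\ I a, I b, a != 0, b != 0 & no_common_prime a b].
Proof.
have [i fi] := forms_neq0 F.
have fR := @factorial_mpoly k 3.
have [|t cop] := coprime_shift (b := f (i + 1)) (c := f (i + 1 + 1)) fR fi.
  move=> p pP p0 p1 p2; apply: (forms_coprime pP) => j.
  by case: (ord3_cases i j) => ->.
exists (f i), (f (i + 1) + t * f (i + 1 + 1)); split=> //.
- exact: form_in_base.
- by rewrite addrC; apply: base_idealD; apply: form_in_base.
(* If [b] were 0, no prime would divide [f i], which would be a unit in the proper ideal [I]. *)
apply/eqP => b0; rewrite b0 in cop.
have [uU|nU] := boolP (f i \is a GRing.unit).
  exact: (unit_notin_base uU (form_in_base i)).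
have [p pP pa] := prime_of_nonunit fR fi nU.
exact: cop pP pa (divides0 _).
Qed.

Section PrimesOverLines.
Variables (t : 'I_3) (P : set R).
Hypotheses (PP : prime_ideal P) (IP : (I `<=` P)%classic)
  (Pt : forall q : {poly k}, P (at_var t q) -> q = 0).

(** In an algebraic equation of [g] over [k[X_t]] modulo [(a, b)], factor out the lowest power of
    [g] that occurs. The cofactor is congruent modulo [P] to a nonzero polynomial in [X_t], hence
    lies outside [P]. *)
Lemma locally_nilpotent a b g : P a -> P b -> a != 0 -> b != 0 ->
  no_common_prime a b -> P g ->
  exists c n, ~ P c /\ span2 setT a b (c * g ^+ n).
Proof.
move=> Pa Pb a0 b0 cop Pg.
have rel x y : a * x = b * y -> divides b x.
  exact: (coprime_divides (@factorial_mpoly k 3) b0 cop).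
have [D [c [[i0 ci0] sp]]] := algebraic_modulo g t a0 b0 rel.
have ex : exists j : nat, [exists i : 'I_D, (i == j :> nat) && (c i != 0)].
  by exists i0; apply/existsP; exists i0; rewrite eqxx.
case: (ex_minnP ex) => _ /existsP [j /andP[/eqP <- cj]] jmin.
have c0 (i : 'I_D) : (i < j)%N -> c i = 0.
  move=> ij; apply/eqP; apply: contrapT => /negP ci.
  have : (j <= i)%N by apply: jmin; apply/existsP; exists i; rewrite eqxx.
  by rewrite leqNgt ij.
exists (\sum_(i : 'I_D | (j <= i)%N) at_var t (c i) * g ^+ (i - j)), j; split.
  rewrite (bigD1 j) //= subnn expr0 mulr1 addrC => Ps.
  case/eqP: cj; apply: Pt; rewrite -[at_var _ _](addKr (\sum_(i : 'I_D | (j <=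
    i)%N && (i != j)) at_var t (c i) * g ^+ (i - j))).
  apply: prime_idealD => //; rewrite -sumrN;
    apply: prime_ideal_sum => // i /andP[ji ne].
  have lt : (j < i)%N by rewrite ltn_neqAle ji andbT eq_sym.
  rewrite -(subnSK lt) exprSr mulrA -mulNr.
  exact: prime_idealMl.
rewrite mulr_suml; move: sp; rewrite (bigID (fun i : 'I_D => (j <= i)%N)) /= addrC.
rewrite big1 ?add0r => [|i]; last by rewrite -ltnNge => /c0 ->; rewrite rmorph0 mul0r.
congr span2; apply: eq_bigr => i ji.
by rewrite -mulrA -exprD subnK.
Qed.

(** For a prime [Q] between [I] and [P], the product [c * g ^+ n] lies in [Q] while [c] does not, so
    [g] does. *)
Lemma prime_over_minimal : minimal_prime I P.
Proof.
split=> // Q QP IQ QsubP g Pg.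
have [a [b [Ia Ib a0 b0 cop]]] := coprime_pair.
have [c [n [Pc [p [q [_ _ e]]]]]] := locally_nilpotent (IP Ia) (IP Ib) a0 b0 cop Pg.
have [_ _ _ QM] := QP.
have : Q (c * g ^+ n).
  by rewrite e mulrC [b * q]mulrC; apply: prime_idealD => //;
    apply: prime_idealMl => //; apply: IQ.
by case/QM => [/QsubP//|]; apply: prime_idealX.
Qed.

End PrimesOverLines.

(** The prime is chosen disjoint from the nonzero polynomials in [X_t]. Its minimality over [I] then
    follows from [prime_over_minimal]. *)
Lemma exists_minimal_prime (t : 'I_3) (J : set R) :
  J 0 -> (forall a x y, J x -> J y -> J (a * x + y)) ->
  (forall i, exists n, J (f i ^+ n)) ->
  (forall q : {poly k}, J (at_var t q) -> q = 0) ->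
  exists P, [/\ prime_ideal P, (J `<=` P)%classic, (I `<=` P)%classic &
     forall q : {poly k}, P (at_var t q) -> q = 0].
Proof.
move=> J0 JD Jf Jt.
pose S : set R := [set x | exists2 q : {poly k}, q != 0 & x = at_var t q]%classic.
have [||x Jx [q q0 e]|P [PP JP PS]] := exists_prime_ideal (S := S) J0 JD.
- by exists 1; rewrite ?oner_neq0 ?rmorph1.
- by move=> _ _ [p p0 ->] [q q0 ->]; exists (p * q); rewrite ?mulf_neq0 ?rmorphM.
- by case/eqP: q0; apply: Jt; rewrite -e.
exists P; split=> //.
  apply: base_ideal_sub => // i; have [n Jn] := Jf i.
  exact: (prime_idealX PP (JP _ Jn)).
move=> q Pq; apply/eqP; apply: contrapT => /negP q0.
by apply: PS Pq _; exists q.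
Qed.

End BaseLocus.

(** * Local generators of the base ideal *)

Section FieldIdentities.
Variable L : fieldType.
Implicit Types a b c x y s : L.

Lemma cross_mulP a b x y s s' : s != 0 -> s' != 0 ->
  a * (x / s) = b * (y / s') -> a * (x * s') = b * (y * s).
Proof.
move=> s0 s'0 e; apply: (lincomb1 (s * s') e).
by field; rewrite s0 s'0.
Qed.

Lemma div_cross a x w s s' : s != 0 -> s' != 0 ->
  x * s' = a * w -> x / s = w / (s * s') * a.
Proof.
move=> s0 s'0 e; apply: (lincomb1 (1 / (s * s')) e).
by field; rewrite s0 s'0.
Qed.

Lemma clear_div3 a b c s s' s'' x y z : s != 0 -> s' != 0 -> s'' != 0 ->
  a / s * x = b / s' * y + c / s'' * z ->
  a * (s' * s'') * x = b * (s * s'') * y + c * (s * s') * z.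
Proof.
move=> s0 s'0 s''0 e; apply: (lincomb1 (s * s' * s'') e).
by field; rewrite s0 s'0 s''0.
Qed.

End FieldIdentities.

Section Localization.
Variables (R : idomainType) (P : set R).
Hypothesis PP : prime_ideal P.
Local Notation L := {fraction R}.
Local Notation S := (localize P setT).

Lemma not_prime_neq0 s : ~ P s -> s != 0.
Proof. by move=> Ps; apply: contra_notN Ps => /eqP ->; case: PP. Qed.

Lemma not_primeM s s' : ~ P s -> ~ P s' -> ~ P (s * s').
Proof. by move=> Ps Ps'; have [_ _ _ PM] := PP => /PM []. Qed.

Lemma local_frac a s : ~ P s -> S (tofrac a / tofrac s).
Proof. by move=> Ps; exists a, s; split. Qed.

Lemma localize_tofrac (J : set R) x : J x -> localize P J (tofrac x).
Proof.
move=> Jx; exists x, 1; split=> //; first by case: PP.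
by rewrite rmorph1 divr1.
Qed.

Lemma localizeM (J : set R) x y : (forall a z, J z -> J (a * z)) ->
  S x -> localize P J y -> localize P J (x * y).
Proof.
move=> JM [a [s [_ Ps ->]]] [b [s' [Jb Ps' ->]]].
exists (a * b), (s * s'); split; [exact: JM|exact: not_primeM|].
by rewrite !rmorphM /= mulf_div.
Qed.

Lemma localizeB (J : set R) x y : (forall a z, J z -> J (a * z)) ->
  (forall z w, J z -> J w -> J (z - w)) ->
  localize P J x -> localize P J y -> localize P J (x - y).
Proof.
move=> JM JB [a [s [Ja Ps ->]]] [b [s' [Jb Ps' ->]]].
exists (s' * a - s * b), (s * s'); split; [by apply: JB; apply: JM|exact: not_primeM|].
rewrite -mulNr addf_div ?tofrac_eq0 ?not_prime_neq0 //.
by rewrite !rmorphM rmorphB !rmorphM /= mulNr; congr ((_ - _) / _); rewrite mulrC.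
Qed.

Lemma localB x y : S x -> S y -> S (x - y).
Proof. exact: localizeB. Qed.

Lemma localM x y : S x -> S y -> S (x * y).
Proof. exact: localizeM. Qed.

Lemma localN x : S x -> S (- x).
Proof. by move=> Sx; rewrite -sub0r; apply: localB => //;
  rewrite -(rmorph0 (@tofrac R)); apply: localize_tofrac. Qed.

Lemma localD x y : S x -> S y -> S (x + y).
Proof. by move=> Sx Sy; rewrite -[y]opprK; apply: localB => //; apply: localN. Qed.

Lemma local_primeM x y : S x -> localize P P y -> localize P P (x * y).
Proof. by apply: localizeM => a z; apply: prime_idealMl. Qed.

Lemma local_primeB x y : localize P P x -> localize P P y -> localize P P (x - y).
Proof.
apply: localizeB => [a z|z w Pz Pw]; first exact: prime_idealMl.
by rewrite addrC -mulN1r; have [_ _ PD _] := PP; apply: PD.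
Qed.

Lemma local_primeD x y : localize P P x -> localize P P y -> localize P P (x + y).
Proof.
move=> Px Py; rewrite -[y]opprK; apply: local_primeB => //.
rewrite -mulN1r; apply: local_primeM => //; apply: localN.
by rewrite -(rmorph1 (@tofrac R)); apply: localize_tofrac.
Qed.

Lemma local_prime1 : ~ localize P P 1.
Proof.
move=> [a [s [Pa Ps e]]]; apply: (Ps).
suff -> : s = a by [].
apply/eqP; rewrite -tofrac_eq; apply/eqP.
have := congr1 ( *%R^~ (tofrac s)) e.
by rewrite /= mul1r mulfVK ?tofrac_eq0 ?not_prime_neq0.
Qed.

Lemma local_relations a b : factorial_ring R -> a != 0 -> b != 0 ->
  no_common_prime a b -> forall x y, S x -> S y ->
  tofrac a * x = tofrac b * y ->
  exists w, [/\ S w, x = w * tofrac b & y = w * tofrac a].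
Proof.
move=> fR a0 b0 cop _ _ [x [s [_ Ps ->]]] [y [s' [_ Ps' ->]]] e.
have s0 := not_prime_neq0 Ps; have s'0 := not_prime_neq0 Ps'.
have e' : a * (x * s') = b * (y * s).
  apply/eqP; rewrite -tofrac_eq; apply/eqP; rewrite !rmorphM /=.
  by apply: cross_mulP e; rewrite tofrac_eq0.
have [w ew] := coprime_divides fR b0 cop e'.
have ew' : y * s = a * w by apply: (mulfI b0); rewrite -e' ew; ring.
exists (tofrac w / tofrac (s * s')); split.
- by exists w, (s * s'); split=> //; apply: not_primeM.
- by rewrite rmorphM; apply: div_cross; rewrite ?tofrac_eq0 // -!rmorphM ew.
- by rewrite rmorphM mulrC [_ * tofrac s']mulrC mulrC; apply: div_cross;
  rewrite ?tofrac_eq0 // -!rmorphM ew'.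
Qed.

End Localization.

Lemma ideal_span_take1 (A : comNzRingType) (S : set A) (g : seq A) z x :
  g = [:: z] -> ideal_span S g x -> exists2 c, S c & x = z * c.
Proof.
by move=> -> [c [Sc ->]]; exists (c 0); rewrite // big_ord1 mulrC.
Qed.

Lemma ideal_span_pair (A : idomainType) (S : set A) z1 z2 x :
  S 0 -> ideal_span S [:: z1; z2] x <-> span2 S z1 z2 x.
Proof.
move=> S0; split=> [[c [Sc ->]]|[p [q [Sp Sq ->]]]].
  by exists (c 0), (c 1%N); split=> //;
    rewrite big_ord_recl big_ord1 /= mulrC [z2 * _]mulrC.
exists (fun i => if i is 0 then p else if i is 1%N then q else 0); split.
  by move=> [|[|i]].
by rewrite big_ord_recl big_ord1 /= mulrC [z2 * _]mulrC.
Qed.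

Section TwoGenerators.
Variables (k : fieldType) (F : rational_map k).
Hypothesis codimF : has_height (base_ideal F) 2.
Variables (t : 'I_3) (P : set {mpoly k[3]}).
Hypotheses (PP : prime_ideal P) (IP : (base_ideal F `<=` P)%classic)
  (Pt : forall q : {poly k}, P (at_var t q) -> q = 0).

Local Notation R := {mpoly k[3]}.
Local Notation L := {fraction R}.
Local Notation f := (tnth (forms F)).
Local Notation I := (base_ideal F).
Local Notation S := (localize P setT).
Local Notation tf := (@tofrac R).

Let tofracS x : S (tf x). Proof. exact: localize_tofrac. Qed.
Let S0 : S 0. Proof. by rewrite -(rmorph0 tf); apply: tofracS. Qed.
Let S1 : S 1. Proof. by rewrite -(rmorph1 tf); apply: tofracS. Qed.

Lemma local_base (z : L) : localize P I z <->
  exists c : 'I_3 -> L, (forall i, S (c i)) /\ z = \sum_i c i * tf (f i).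
Proof.
split=> [[_ [s [[c ->] Ps ->]]]|[c [Sc ->]]].
  exists (fun i => tf (c i) / tf s); split; first by move=> i; apply: local_frac.
  by rewrite rmorph_sum mulr_suml; apply: eq_bigr => i _; rewrite rmorphM mulrAC.
have IM a x : I x -> I (a * x).
  by move=> Ix; rewrite -[a * x]addr0; apply: base_idealD => //;
    exists (fun=> 0); rewrite big1 // => i _; rewrite mul0r.
have IB x y : I x -> I y -> I (x - y).
  by move=> Ix Iy; rewrite addrC -mulN1r; apply: base_idealD.
have ID x y : localize P I x -> localize P I y -> localize P I (x + y).
  move=> Ix Iy; rewrite -[y]opprK; apply: (localizeB PP) => //.
  rewrite -mulN1r; apply: (localizeM PP) => //; exact: localN.
elim/big_ind: _ => //.
  by rewrite -(rmorph0 tf); apply: localize_tofrac => //; rewrite -(mul0r 0);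
    apply: IM; exists (fun=> 0); rewrite big1 // => i _; rewrite mul0r.
by move=> i _; apply: (localizeM PP) => //; apply: localize_tofrac => //;
  apply: form_in_base.
Qed.

Lemma local_base_prime z : localize P I z -> localize P P z.
Proof. by move=> [a [s [Ia Ps ->]]]; exists a, s; split=> //; apply: IP. Qed.

Lemma clear_denominators l A B C : S A -> S B -> S C -> ~ localize P P A ->
  A * tf (f l) = B * tf (f (l + 1)) + C * tf (f (l + 1 + 1)) ->
  exists c al be, ~ P c /\ c * f l = al * f (l + 1) + be * f (l + 1 + 1).
Proof.
move=> [a [s [_ Ps ->]]] [b [s' [_ Ps' ->]]] [c [s'' [_ Ps'' ->]]] nPA e.
have [s0 s'0 s''0] : [/\ s != 0, s' != 0 & s'' != 0] by split;
  apply: not_prime_neq0 PP _ _.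
exists (a * (s' * s'')), (b * (s * s'')), (c * (s * s')); split.
  apply: not_primeM => //; last exact: not_primeM.
  by move=> Pa; apply: nPA; exists a, s.
apply/eqP; rewrite -tofrac_eq; apply/eqP; rewrite rmorphD !rmorphM /=.
by apply: clear_div3 e; rewrite tofrac_eq0.
Qed.

(** With three regular elements in [I_P], the ideal [(a, b)] would be saturated with respect to
    them, hence with respect to the three forms. Powers of the forms lie in [(a, b)] locally, so 1
    would too. This stands in for the bound of depth by height. *)
Lemma no_regular_triple z1 z2 z3 g :
  regular_sequence S [:: z1, z2, z3 & g] ->
  ideal_span S [:: z1, z2, z3 & g] = localize P I -> False.
Proof.
move=> [gS g1 greg] gI.
have SB := localB PP; have SM := localM PP.
have Sz : [/\ S z1, S z2 & S z3] by split; apply: gS; rewrite !inE eqxx ?orbT.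
have [Sz1 Sz2 Sz3] := Sz.
have [a [b [Ia Ib a0 b0 cop]]] := coprime_pair codimF.
have fR := @factorial_mpoly k 3.
have rel := local_relations PP fR a0 b0 cop.
have z10 : z1 != 0.
  apply/eqP => z10; have := greg 0 isT 1 S1; rewrite /= z10 mul0r.
  case; first by exists (fun=> 0); split=> //; rewrite big_ord0.
  by move=> c [_ /eqP]; rewrite big_ord0 oner_eq0.
have reg2 x y : S x -> S y -> z2 * x = z1 * y -> exists2 w, S w & x = z1 * w.
  move=> Sx Sy e; apply: (ideal_span_take1 (g := take 1 [:: z1, z2, z3 & g])) => //.
  by apply: (greg 1%N) => //=; exists (fun=> y); split=> //;
    rewrite big_ord1 /= e mulrC.
have reg3 x : S x -> span2 S z1 z2 (z3 * x) -> span2 S z1 z2 x.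
  move=> Sx sp; apply/(ideal_span_pair z1 z2 x S0).
  by have := greg 2 isT x Sx; rewrite /= ?take0; apply; apply/ideal_span_pair.
have zI z : z \in [:: z1; z2; z3] -> localize P I z.
  move=> zin; rewrite -gI.
  pose i := index z [:: z1; z2; z3].
  have ilt : (i < size [:: z1, z2, z3 & g])%N by rewrite /= (leq_trans (n :=
    3)) // -[3%N]/(size [:: z1; z2; z3]) index_mem.
  exists (fun j => (j == i)%:R); split; first by move=> j; case: (j == i).
  rewrite (bigD1 (Ordinal ilt)) //= eqxx mul1r big1 ?addr0.
    have := nth_index 0 zin; rewrite -/i;
      have : (i < 3)%N by rewrite -[3%N]/(size [:: z1; z2; z3]) index_mem.
    by case: i {ilt} => [|[|[|]]].
  by move=> j ne; rewrite -(inj_eq val_inj) /= in ne; rewrite (negbTE ne) mul0r.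
have spD := @span2D _ S SB.
pose J : set R := fun u => span2 S (tf a) (tf b) (tf u).
have JM c u : J u -> J (c * u).
  by rewrite /J rmorphM => Ju; apply: (span2Ml SM) => //; apply: tofracS.
have Jz u z : z \in [:: z1; z2;
  z3] -> (forall i, J (f i * u)) -> span2 S (tf a) (tf b) (z * tf u).
  move=> /zI /local_base [c [Sc ->]] Jf; rewrite mulr_suml.
  elim/big_ind: _ => [||i _]; [by exists 0, 0; rewrite !mulr0 addr0|exact: spD|].
  by rewrite -mulrA -rmorphM; apply: (span2Ml SM); [exact: Sc|exact: Jf].
have sat u : J (f 0 * u) -> J (f (0 + 1) * u) -> J (f (0 + 1 + 1) * u) -> J u.
  move=> J0 J1 J2; have Jf i : J (f i * u) by case: (ord3_cases 0 i) => ->.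
  apply: (span2_saturated SB SM Sz1 Sz2 Sz3 z10 reg2 reg3 (tofracS a) (tofracS
    b)) => //.
  - exact: mulrC.
  - by rewrite tofrac_eq0 a0.
  - by apply: Jz => //; rewrite !inE eqxx.
  - by apply: Jz => //; rewrite !inE eqxx orbT.
  - by apply: Jz => //; rewrite !inE eqxx !orbT.
have nilp i : exists n, J (f i ^+ n * 1).
  have [c [n [Pc [p [q [_ _ e]]]]]] := locally_nilpotent PP Pt (IP Ia) (IP Ib)
    a0 b0 cop (IP (form_in_base F i)).
  have c0 := not_prime_neq0 PP Pc.
  exists n, (tf p / tf c), (tf q / tf c); split; [exact: local_frac|exact: local_frac|].
  rewrite mulr1 !mulrA -mulrDl -!rmorphM -rmorphD -e mulrC rmorphM mulKf //.
  by rewrite tofrac_eq0.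
have [n0 J0] := nilp 0; have [n1 J1] := nilp (0 + 1); have [n2 J2] := nilp (0 + 1 + 1).
have [p [q [Sp Sq e]]] := saturated_powers JM sat J0 J1 J2.
apply: (local_prime1 PP); move: e; rewrite rmorph1 => ->; rewrite mulrC [_ * q]mulrC.
by apply: (local_primeD PP); apply: (local_primeM PP) => //;
  apply: localize_tofrac => //; apply: IP.
Qed.

(* When [I_P = (z1, z2)], the maximal minors [D l] of the matrix expressing the
   forms in terms of [z1, z2] give the relation [sum_l D l * f l = 0]. They do
   not all lie in [P]: the matrix has a left inverse modulo [P]. *)
Lemma local_relation_pair z1 z2 :
  regular_sequence S [:: z1; z2] ->
  ideal_span S [:: z1; z2] = localize P I ->
  exists l c al be, ~ P c /\ c * f l = al * f (l + 1) + be * f (l + 1 + 1).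
Proof.
move=> [gS g1 greg] gI.
have SB := localB PP; have SM := localM PP.
have PD := local_primeD PP; have PM := local_primeM PP.
have [Sz1 Sz2] : S z1 /\ S z2 by split; apply: gS; rewrite !inE eqxx ?orbT.
have z10 : z1 != 0.
  apply/eqP => z10; have := greg 0 isT 1 S1; rewrite /= z10 mul0r.
  case; first by exists (fun=> 0); split=> //; rewrite big_ord0.
  by move=> c [_ /eqP]; rewrite big_ord0 oner_eq0.
have reg2 x y : S x -> S y -> z2 * x = z1 * y -> exists2 w, S w & x = z1 * w.
  move=> Sx Sy e; apply: (ideal_span_take1 (g := take 1 [:: z1; z2])) => //.
  by apply: (greg 1%N) => //=; exists (fun=> y); split=> //;
    rewrite big_ord1 /= e mulrC.
have zI z : span2 S z1 z2 z <-> localize P I z.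
  by rewrite -gI; apply: iff_sym; apply: ideal_span_pair.
have Iz1 : localize P I z1 by apply/zI; exists 1, 0; rewrite mulr1 mulr0 addr0.
have Iz2 : localize P I z2 by apply/zI; exists 0, 1; rewrite mulr1 mulr0 add0r.
have Pz1 := local_base_prime Iz1; have Pz2 := local_base_prime Iz2.
have fz i : exists ab : L * L, [/\ S ab.1, S ab.2 & tf (f i) = z1 * ab.1 + z2 * ab.2].
  have /zI [p [q [Sp Sq e]]] : localize P I (tf (f i)).
    by apply: localize_tofrac => //; apply: form_in_base.
  by exists (p, q).
have [ab abP] := choice fz.
pose A i := (ab i).1; pose B i := (ab i).2.
have SA i : S (A i) by case: (abP i).
have SB' i : S (B i) by case: (abP i).
have fE i : tf (f i) = z1 * A i + z2 * B i by case: (abP i).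
pose D l := A (l + 1) * B (l + 1 + 1) - A (l + 1 + 1) * B (l + 1).
have SD l : S (D l) by apply: (SB); apply: (SM).
have [l nPD] : exists l, ~ localize P P (D l).
  apply: contrapT => H.
  have PDl l : localize P P (D l) by apply: contrapT => nP; apply: H; exists l.
  have /local_base [c [Sc e1]] := Iz1; have /local_base [c' [Sc' e2]] := Iz2.
  have rel (d : 'I_3 -> L) z : (forall i, S (d i)) -> z = \sum_i d i * tf (f i) ->
      exists p q, [/\ S p, S q, z = p * z1 + q * z2, p = \sum_i d i * A i & q =
        \sum_i d i * B i].
    move=> Sd ->; exists (\sum_i d i * A i), (\sum_i d i * B i); split=> //.
    - by elim/big_ind: _ => // [x y|i _]; [apply: (localD PP)|apply: (SM)].
    - by elim/big_ind: _ => // [x y|i _]; [apply: (localD PP)|apply: (SM)].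
    - rewrite !mulr_suml -big_split /=; apply: eq_bigr => i _; rewrite fE; ring.
  have [p [q [Sp Sq e ep eq]]] := rel c z1 Sc e1.
  have [p' [q' [Sp' Sq' e' ep' eq']]] := rel c' z2 Sc' e2.
  (* Regularity applied to [(1 - p) * z1 = q * z2] puts [1 - p] and [q] in [(z1, z2)]; likewise
     [1 - q']. The matrix with rows [(p, q)] and [(p', q')] thus has determinant 1 modulo [P]. *)
  have [||w Sw ew] := reg2 q (1 - p) Sq _ _; first exact: (SB).
    by apply: (lincomb1 (- 1) e); ring.
  have [||w' Sw' ew'] := reg2 (1 - q') p' _ Sp' _; first exact: (SB).
    by apply: (lincomb1 1 e'); ring.
  have p1 : 1 - p = z2 * w.
    by apply: (mulfI z10); apply: (lincomb2 1 z2 e ew); ring.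
  apply: (local_prime1 PP).
  have -> : 1 = (p * q' - q * p') + ((1 - p) + (p * (1 - q') + q * p')) by ring.
  apply: (PD).
    (* The formula of Cauchy and Binet: the determinant is a combination of the minors [D l], hence
       in [P] by assumption. *)
    have -> : p * q' - q * p' = \sum_l (c (l + 1) * c' (l + 1 + 1) - c (l + 1 +
      1) * c' (l + 1)) * D l.
      have e3 : (0 + 1 + 1 + 1 : 'I_3) = 0 by apply: val_inj.
      rewrite ep eq ep' eq' !(sum_ord3 0) /D !e3; ring.
    elim/big_ind: _ => [|x y|i _].
    - by rewrite -(rmorph0 tf); apply: localize_tofrac => //; case: PP.
    - exact: (PD).
    - by apply: (PM) => //; apply: (SB); apply: (SM).
  rewrite p1 ew' ew; apply: (PD); first by rewrite mulrC; apply: (PM).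
  apply: (PD); first by apply: (PM) => //; rewrite mulrC; apply: (PM).
  by rewrite mulrC; apply: (PM) => //; rewrite mulrC; apply: (PM).
exists l; apply: (@clear_denominators l (D l) (- D (l + 1)) (- D (l + 1 + 1))) => //.
- exact: localN.
- exact: localN.
have e3 : l + 1 + 1 + 1 = l by apply: val_inj; case: (l) => -[|[|[|//]]] ?.
rewrite !fE /D !e3; ring.
Qed.

(** The length of the regular sequence decides: 0 would make all forms vanish; with 1, a form whose
    coefficient is a unit generates [I_P]; with 2, the minors give the relation; 3 or more is
    excluded. *)
Lemma locally_two_generated : locally_ci_at_minimal_primes I ->
  exists l c al be, ~ P c /\ c * f l = al * f (l + 1) + be * f (l + 1 + 1).
Proof.
move=> lci; have [g] := lci P (prime_over_minimal codimF PP IP Pt).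
case: g => [|z1 [|z2 [|z3 g]]] [greg gI].
- have [i fi] := forms_neq0 F.
  have : localize P I (tf (f i)) by apply: localize_tofrac => //; apply: form_in_base.
  by rewrite -gI => -[c [_ /eqP]]; rewrite big_ord0 tofrac_eq0 (negbTE fi).
- have [gS g1 _] := greg.
  have fz i : exists2 c, S c & tf (f i) = z1 * c.
    by apply: (ideal_span_take1 (g := [:: z1])) => //; rewrite gI;
      apply: localize_tofrac => //; apply: form_in_base.
  have Iz : localize P I z1.
    rewrite -gI; exists (fun=> 1); split=> //; by rewrite big_ord1 mul1r.
  have z0 : z1 != 0.
    have [i fi] := forms_neq0 F; have [c _ e] := fz i.
    by apply: contraNneq fi => z0; rewrite -tofrac_eq0 e z0 mul0r.
  have [A AP] := choice (fun i => let: ex_intro2 c Sc e := fz i in ex_intro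
    (fun c => S c /\ tf (f i) = z1 * c) c (conj Sc e)).
  have [i nPA] : exists i, ~ localize P P (A i).
    apply: contrapT => H.
    have PA i : localize P P (A i) by apply: contrapT => nP; apply: H; exists i.
    have /local_base [c [Sc e]] := Iz; apply: (local_prime1 PP).
    have -> : 1 = \sum_i c i * A i.
      apply: (mulfI z0); rewrite mulr1 [LHS]e mulr_sumr; apply: eq_bigr => i _.
      by have [_ ->] := AP i; rewrite mulrCA.
    elim/big_ind: _ => [|x y|j _]; [|exact: local_primeD|by apply: local_primeM].
    by rewrite -(rmorph0 tf); apply: localize_tofrac => //; case: PP.
  have e3 : i + 1 + 1 + 1 = i by apply: val_inj; case: (i) => -[|[|[|//]]] ?.
  (* With [l = i + 1] the generating form [f i] is in the last place, [l + 1 + 1 = i]. *)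
  exists (i + 1); apply: (@clear_denominators (i + 1) (A i) 0 (A (i + 1))) => //.
  + by case: (AP i).
  + by case: (AP (i + 1)).
  by rewrite e3; have [_ ->] := AP i; have [_ ->] := AP (i + 1); ring.
- exact: local_relation_pair greg gI.
- by case: (no_regular_triple greg gI).
Qed.

End TwoGenerators.

(** * Equations of the Rees algebra *)

Lemma ord3_distinct (l i j : 'I_3) : l != i -> l != j -> i != j ->
  forall m, [\/ m = l, m = i | m = j].
Proof.
move=> li lj ij m; have : [|| m == l, m == i | m == j].
  move: li lj ij; case: l => -[|[|[|//]]] ?; case: i => -[|[|[|//]]] ? //;
  case: j => -[|[|[|//]]] ? //; by case: m => -[|[|[|//]]] ?.
by case/or3P => /eqP ->; [constructor 1|constructor 2|constructor 3].
Qed.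

Section Evaluation.
Variables (A T : comNzRingType) (n : nat).
Implicit Types (phi : {rmorphism A -> T}) (v w : 'I_n -> T) (H : {mpoly A[n]}).

Lemma mmap_congr (J : set T) phi v w H :
  J 0 -> (forall a x y, J x -> J y -> J (a * x + y)) ->
  (forall i, J (v i - w i)) -> J (mmap phi v H - mmap phi w H).
Proof.
move=> J0 JD vw; have JM a x : J x -> J (a * x).
  by move=> Jx; rewrite -[a * x]addr0; apply: JD.
have JA x y : J x -> J y -> J (x + y) by move=> Jx; rewrite -[x]mul1r; apply: JD.
have mulc x y x' y' : J (x - x') -> J (y - y') -> J (x * y - x' * y').
  move=> Jx Jy; have -> : x * y - x' * y' = y * (x - x') + x' * (y - y') by ring.
  by apply: JD => //; apply: JM.
rewrite /mmap -sumrB; elim/big_ind: _ => [//|x y|m _]; first exact: JA.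
rewrite -mulrBr; apply: JM; rewrite /mmap1.
apply: (big_ind2 (fun x y => J (x - y))) => [|x x' y y'|i _]; first by rewrite subrr.
  exact: mulc.
elim: (m i) => [|e IH]; first by rewrite !expr0 subrr.
by rewrite !exprS; apply: mulc.
Qed.

Lemma mmap_homog phi c v d H : H \is d.-homog ->
  mmap phi (fun i => c * v i) H = c ^+ d * mmap phi v H.
Proof.
move=> /dhomogP Hd; rewrite /mmap mulr_sumr; apply: eq_big_seq => m mH.
rewrite mulrCA; congr (_ * _); have {}Hd : mdeg m = d := Hd m mH.
rewrite -Hd mdegE -prodrXr /mmap1 -big_split.
by apply: eq_bigr => i _; rewrite exprMn.
Qed.

End Evaluation.

Lemma mmap_morph (A T U : comNzRingType) n (phi : {rmorphism A -> T})
    (psi : {rmorphism A -> U}) (theta : {rmorphism T -> U}) v w (H : {mpoly A[n]}) :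
  (forall a, theta (phi a) = psi a) -> (forall i, theta (v i) = w i) ->
  theta (mmap phi v H) = mmap psi w H.
Proof.
move=> tphi tv; rewrite /mmap rmorph_sum; apply: eq_bigr => m _.
rewrite rmorphM tphi /mmap1 rmorph_prod; congr (_ * _).
by apply: eq_bigr => i _; rewrite rmorphXn tv.
Qed.

Section LinearSyzygies.
Variables (k K : fieldType) (iota : {rmorphism k -> K}) (F : rational_map k).
Variable (Y : 'I_3 -> K).
Hypothesis Y0 : forall i, Y i != 0.

Local Notation R := {mpoly k[3]}.
Local Notation RK := {mpoly K[3]}.
Local Notation f := (tnth (forms F)).
Local Notation ext := (map_mpoly iota : {rmorphism R -> RK}).

Let YC i : RK := (Y i)%:MP.

(* The fibre over the point [Y] of the symmetric algebra of the base ideal is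
   defined by the linear forms [sum_i s i * Y i], [s] a syzygy. *)
Definition syzygy_ideal : set RK :=
  [set u | exists s : 'I_3 -> RK, u = \sum_i s i * YC i /\ \sum_i s i * ext (f
    i) = 0]%classic.

Local Notation J := syzygy_ideal.

Lemma syzygy_idealD a x y : J x -> J y -> J (a * x + y).
Proof.
move=> [s [-> es]] [s' [-> es']]; exists (fun i => a * s i + s' i); split.
  by rewrite mulr_sumr -big_split /=; apply: eq_bigr => i _; ring.
rewrite (eq_bigr (fun i => a * (s i * ext (f i)) + s' i * ext (f i))) => [|i
  _]; last by ring.
by rewrite big_split /= -mulr_sumr es es' mulr0 addr0.
Qed.

Lemma syzygy_ideal0 : J 0.
Proof. by exists (fun=> 0); split; rewrite big1 // => i _; rewrite mul0r. Qed.

Lemma syzygy_idealM a x : J x -> J (a * x).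
Proof. by move=> Jx; rewrite -[a * x]addr0; apply: syzygy_idealD => //;
  apply: syzygy_ideal0. Qed.

Lemma syzygy_idealB x y : J (x - y) -> J y -> J x.
Proof. by move=> Jxy Jy; rewrite -[x](subrK y) -[x - y]mul1r; apply: syzygy_idealD. Qed.

Lemma syzygy_ideal_sum l i j (u v w : RK) : l != i -> l != j -> i != j ->
  u * ext (f l) + v * ext (f i) + w * ext (f j) = 0 ->
  J (u * YC l + v * YC i + w * YC j).
Proof.
move=> li lj ij e; pose s m := if m == l then u else if m == i then v else w.
have sE (G : 'I_3 -> RK) : \sum_m s m * G m = u * G l + v * G i + w * G j.
  rewrite (bigD1 l) // (bigD1 i) /=; last by rewrite eq_sym.
  rewrite (bigD1 j) /=; last by rewrite eq_sym lj eq_sym ij.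
  rewrite big1 => [|m /andP[/andP[ml mi] mj]].
    rewrite /s !eqxx ![_ == l]eq_sym (negbTE li) (negbTE lj) [j == i]eq_sym (negbTE ij).
    by rewrite addr0 addrA.
  by case: (ord3_distinct li lj ij m) ml mi mj => ->; rewrite eqxx.
by exists s; rewrite !sE.
Qed.

(** The Koszul syzygies: modulo the syzygy ideal, the point [Y] is proportional to the vector of
    forms. *)
Lemma syzygy_ideal_koszul i j : J (ext (f i) * YC j - ext (f j) * YC i).
Proof.
pose s l : RK := ext (f i) * (l == j)%:R - ext (f j) * (l == i)%:R.
have sE (G : 'I_3 -> RK) : \sum_l s l * G l = ext (f i) * G j - ext (f j) * G i.
  have D c l0 : \sum_l c * (l == l0)%:R * G l = c * G l0.
    rewrite (bigD1 l0) //= eqxx mulr1 big1 ?addr0 // => l /negbTE ->.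
    by rewrite mulr0 mul0r.
  by rewrite -!D -sumrB; apply: eq_bigr => l _; rewrite mulrBl.
by exists s; rewrite !sE; split=> //; rewrite mulrC subrr.
Qed.

Section Form.
Variables (e : nat) (H : {mpoly R[3]}).
Hypotheses (He : H \is e.-homog) (Hf : H.@[f] = 0).

Local Notation HY := (mmap ext YC H).

Lemma ext_form : mmap ext (fun i => ext (f i)) H = 0.
Proof.
by rewrite -(@mmap_morph _ _ _ _ idfun ext ext f) // -/(meval f H) Hf rmorph0.
Qed.

(** By the Koszul syzygies, [f_i ^ e * H(Y) = H(f_i * Y)] is congruent to
    [H(Y_i * f) = Y_i ^ e * H(f) = 0]. *)
Lemma conductor_power i : J (ext (f i ^+ e) * HY).
Proof.
rewrite rmorphXn -(mmap_homog _ _ _ He).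
apply: (syzygy_idealB (y := mmap ext (fun j => YC i * ext (f j)) H)); last first.
  by rewrite (mmap_homog _ _ _ He) ext_form mulr0; apply: syzygy_ideal0.
apply: mmap_congr; [exact: syzygy_ideal0|exact: syzygy_idealD|move=> j].
by rewrite [YC i * _]mulrC; apply: syzygy_ideal_koszul.
Qed.

(** Where [c] is invertible, two forms generate the ideal, and [H] becomes a polynomial in their
    ratio. It vanishes at [f_i / f_j], so by Gauss's lemma it is a multiple of a linear polynomial,
    which comes from the syzygy between [f_i] and [f_j]. *)
Lemma conductor_relation_aux l i j c al be : l != i -> l != j -> i != j ->
  c * f l = al * f i + be * f j -> f j != 0 -> J (ext (c ^+ e) * HY).
Proof.
move=> li lj ij rel fj0.
have fR := @factorial_mpoly k 3.
have [g [b [a [ej ei cop]]]] := gcd_split (f i) fR fj0.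
have /andP[g0 b0] : (g != 0) && (b != 0) by rewrite -negb_or -mulf_eq0 -ej.
have lF : (i == l) = false by rewrite eq_sym (negbTE li).
have jF : (j == l) = false by rewrite eq_sym (negbTE lj).
have jiF : (j == i) = false by rewrite eq_sym (negbTE ij).
pose pick (T : Type) (x y z : T) (m : 'I_3) := if m == l then x else if m == i
  then y else z.
(* [W] is [c] times the vector of forms, divided by [f j], with ['X] in place of [f_i / f_j] and the
   relation used for the index [l]. [Q] is the primitive equation of this ratio [a / b]. *)
pose W := pick {poly R} (al%:P * 'X + be%:P) (c%:P * 'X) c%:P.
pose h := mmap polyC W H; pose Q := b%:P * 'X - a%:P.
have Q0 : divides Q (b%:P ^+ e * h).
  rewrite -(mmap_homog _ _ _ He).
  pose w := pick R (al * a + be * b) (c * a) (c * b).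
  have -> : mmap polyC (fun m => b%:P * W m) H =
      mmap polyC (fun m => b%:P * W m) H - mmap polyC (fun m => (w m)%:P) H.
    have wP : polyC (mmap idfun w H) = mmap polyC (fun m => (w m)%:P) H by
      apply: mmap_morph.
    suff w0 : mmap idfun w H = 0 by rewrite -wP w0 rmorph0 subr0.
    (* [g * w] is [c] times the vector of forms, at which [H] vanishes; the power of [g] is then
       cancelled. *)
    have ge0 : g ^+ e != 0 by rewrite expf_neq0.
    apply: (mulfI ge0); rewrite mulr0 -(mmap_homog _ _ _ He).
    rewrite [LHS](_ : _ = mmap idfun (fun m => c * f m) H).
      by rewrite (mmap_homog _ _ _ He) -/(meval f H) Hf mulr0.
    rewrite /mmap; apply: eq_bigr => m _; congr (_ * _); rewrite /mmap1;
      apply: eq_bigr => n _.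
    congr (_ ^+ _); rewrite /w /pick.
    case: (ord3_distinct li lj ij n) => ->; rewrite ?eqxx ?lF ?jF ?jiF.
    - by rewrite rel ei ej; ring.
    - by rewrite ei; ring.
    - by rewrite ej; ring.
  apply: mmap_congr => [|x y z|m]; first exact: divides0.
    by move=> Qy Qz; apply: dividesD => //; apply: divides_mull.
  rewrite /W /w /pick; case: ifP => _; [|case: ifP => _].
  - by exists al%:P; rewrite /Q !(rmorphD, rmorphM) /=; ring.
  - by exists c%:P; rewrite /Q !rmorphM /=; ring.
  - by exists 0; rewrite rmorphM /=; ring.
have Qprim : primitive Q.
  move=> p pP /divides_polyC pQ; apply: (cop p pP).
    by have := pQ 1%N; rewrite coefB coefMX !coefC /= subr0.
  have := pQ 0; rewrite coefB coefMX !coefC /= sub0r => -[x ex].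
  by exists (- x); rewrite mulrN -ex opprK.
have [q hq] : divides Q h.
  by apply: (primitive_divides fR _ Qprim (c := b ^+ e));
    rewrite ?expf_neq0 // rmorphXn.
(* Setting ['X] to [Y_i / Y_j] and multiplying by [Y_j] makes [Q] the linear form
   [b * Y_i - a * Y_j] of a syzygy, and [W] the vector [V], which is congruent to [c * Y]. *)
pose ev : {rmorphism {poly R} -> RK} :=
  horner_eval ((Y i / Y j)%:MP : RK) \o map_poly ext.
have evC x : ev x%:P = ext x by rewrite /= map_polyC /horner_eval hornerC.
have evX : ev 'X = (Y i / Y j)%:MP by rewrite /= map_polyX /horner_eval hornerX.
have YX : YC j * ev 'X = YC i by rewrite evX -rmorphM mulrC divfK.
pose V := pick RK (ext al * YC i + ext be * YC j) (ext c * YC i) (ext c * YC j).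
have JV : J (mmap ext V H).
  have -> : mmap ext V H = YC j ^+ e * ev h.
    rewrite (@mmap_morph _ _ _ _ polyC ext ev W (fun m => ev (W m))) //.
    rewrite -(mmap_homog _ _ _ He); rewrite /mmap; apply: eq_bigr => m _; congr (_ * _).
    rewrite /mmap1; apply: eq_bigr => n _; congr (_ ^+ _); rewrite /V /W /pick.
    case: ifP => _; [|case: ifP => _].
    - by rewrite rmorphD rmorphM !evC mulrDr mulrCA YX [YC j * _]mulrC.
    - by rewrite rmorphM !evC mulrCA YX.
    - by rewrite evC mulrC.
  have -> : YC j ^+ e * ev h = YC j ^+ e * ev q * ((Y j)^-1)%:MP * (ext b * YC
    i + - ext a * YC j + 0 * YC l).
    have Yj1 : YC j * ((Y j)^-1)%:MP = 1 by rewrite -rmorphM mulfV ?rmorph1.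
    have evQ : ev Q = ext b * ev 'X - ext a by rewrite rmorphB rmorphM !evC.
    rewrite hq rmorphM evQ -YX.
    by apply: (lincomb1 (- (YC j ^+ e * ev q * (ext b * ev 'X - ext a))) Yj1); ring.
  apply: syzygy_idealM; apply: syzygy_ideal_sum => //;
    [by rewrite eq_sym|by rewrite eq_sym|].
  by rewrite ei ej !rmorphM; ring.
apply: (syzygy_idealB _ JV); rewrite rmorphXn -(mmap_homog _ _ _ He).
apply: mmap_congr => [|x y z|m]; [exact: syzygy_ideal0|exact: syzygy_idealD|].
rewrite /V /pick.
case: (ord3_distinct li lj ij m) => ->; rewrite ?eqxx ?lF ?jF ?jiF ?subrr;
  try exact: syzygy_ideal0.
rewrite opprD addrA -!mulNr; apply: syzygy_ideal_sum => //.
by rewrite -!rmorphN -!rmorphM -!rmorphD rel -[RHS](rmorph0 ext); congr (ext _); ring.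
Qed.

Lemma conductor_relation l c al be : c != 0 ->
  c * f l = al * f (l + 1) + be * f (l + 1 + 1) -> J (ext (c ^+ e) * HY).
Proof.
move=> c0 rel.
have n1 : l != l + 1 by case: (l) => -[|[|[|//]]] ?.
have n2 : l != l + 1 + 1 by case: (l) => -[|[|[|//]]] ?.
have n3 : l + 1 != l + 1 + 1 by case: (l) => -[|[|[|//]]] ?.
have [f20|f20] := eqVneq (f (l + 1 + 1)) 0;
  last exact: conductor_relation_aux n1 n2 n3 rel f20.
have [f10|f10] := eqVneq (f (l + 1)) 0.
  have [m fm] := forms_neq0 F; case/eqP: fm.
  have : c * f l = 0 by rewrite rel f10 f20 !mulr0 addr0.
  by move/eqP; rewrite mulf_eq0 (negbTE c0) => /eqP; case: (ord3_cases l m) => ->.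
apply: (conductor_relation_aux n2 n1 _ (al := be) (be := al)) => //;
  first by rewrite eq_sym.
by rewrite rel addrC.
Qed.

End Form.
End LinearSyzygies.

Lemma pihomogM (R : comNzRingType) n d m (p g : {mpoly R[n]}) : g \is d.-homog ->
  pihomog mdeg m (p * g) = if (d <= m)%N then pihomog mdeg (m - d) p * g else 0.
Proof.
move=> gd; rewrite [p in LHS](pihomog_partitionE (k := msize p) (mf := mdeg))
  // mulr_suml raddf_sum /=.
have term e : pihomog mdeg m (pihomog mdeg e p * g) =
    if (e + d == m)%N then pihomog mdeg e p * g else 0.
  have hom : pihomog mdeg e p * g \is (e + d).-homog by apply: dhomogM => //;
    apply: pihomogP.
  case: eqP => [<-|/eqP ne]; first exact: pihomog_dE.
  exact: (pihomog_ne0 ne hom).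
under eq_bigr => e _ do rewrite term.
case: leqP => [dm|md]; last first.
  by rewrite big1 // => e _; case: eqP => // em; move: md; rewrite -em ltnNge leq_addl.
have [lt|ge] := ltnP (m - d) (msize p).
  rewrite (bigD1 (Ordinal lt)) //= subnK // eqxx big1 ?addr0 // => e ne.
  case: eqP => // em; case/eqP: ne; apply: val_inj => /=; lia.
rewrite big1 => [|e _]; last by case: eqP => // em; have := ltn_ord e; lia.
rewrite (_ : pihomog _ _ _ = 0) ?mul0r // pihomogE big_seq_cond big1 // => m'
  /andP[m'p /eqP e].
by have := msize_mdeg_lt m'p; move: ge; rewrite -e leqNgt => /negbTE ->.
Qed.

Lemma pihomogMC (R : comNzRingType) n m (p : {mpoly R[n]}) c :
  pihomog mdeg m (p * c%:MP) = pihomog mdeg m p * c%:MP.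
Proof. by rewrite mulrC mul_mpolyC linearZ /= -mul_mpolyC mulrC. Qed.

Lemma map_mpoly_homog (A B : nzRingType) (phi : {rmorphism A -> B}) n d (p :
  {mpoly A[n]}) :
  p \is d.-homog -> map_mpoly phi p \is d.-homog.
Proof.
move/dhomogP => pd; apply/dhomogP => m; rewrite mcoeff_msupp mcoeff_map_mpoly => nz.
by apply: pd; rewrite mcoeff_msupp; apply: contraNneq nz => ->; apply/eqP/raddf0.
Qed.

Lemma at_var_map (k K : fieldType) (iota : {rmorphism k -> K}) n (t : 'I_n) (q
  : {poly k}) :
  map_mpoly iota (at_var t q) = at_var t (map_poly iota q).
Proof.
rewrite !at_varE rmorph_sum size_map_poly; apply: eq_bigr => i _ /=.
by rewrite map_mpolyZ rmorphXn coef_map; congr (_ *: _ ^+ _); apply: map_mpolyX.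
Qed.

Section Variables.
Variables (K : fieldType) (n : nat).
Local Notation RK := {mpoly K[n]}.

Definition kill (S : pred 'I_n) : {mpoly K[n]} -> {mpoly K[n]} :=
  comp_mpoly [tuple if S i then 0 else 'X_i | i < n].

HB.instance Definition _ S := GRing.RMorphism.copy (kill S)
  (comp_mpoly [tuple if S i then 0 else 'X_i | i < n]).

Lemma killX S i : kill S 'X_i = if S i then 0 else 'X_i.
Proof. by rewrite /kill comp_mpolyXU -tnth_nth tnth_mktuple. Qed.

(** Replacing the variables of [S] by 0 does not change [p] modulo [J]: the kernel of [kill S] is
    generated by these variables. *)
Lemma sub_kill (J : set RK) (S : pred 'I_n) p :
  J 0 -> (forall a x y, J x -> J y -> J (a * x + y)) ->
  (forall i, S i -> J 'X_i) -> kill S p = 0 -> J p.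
Proof.
move=> J0 JD JX kp; rewrite -[p]subr0 -kp -{1}[p]comp_mpoly_id.
apply: mmap_congr => // i; rewrite !tnth_mktuple; case: ifP => [/JX|];
  first by rewrite subr0.
by rewrite subrr.
Qed.

Lemma mpolyX_neq0 (i : 'I_n) : 'X_i != 0 :> RK.
Proof. by rewrite -msize_poly_eq0 msizeX. Qed.

Lemma variables_regular2 (i j : 'I_n) x y : i != j ->
  'X_j * x = 'X_i * y -> divides ('X_i : RK) x.
Proof.
move=> ij e; apply: (@sub_kill _ (pred1 i)) => [|a u v|l /eqP ->|].
- exact: divides0.
- by move=> du dv; apply: dividesD => //; apply: divides_mull.
- exact: divides_refl.
- have := congr1 (kill (pred1 i)) e;
  rewrite !rmorphM /= !killX /= eqxx mul0r eq_sym (negbTE ij).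
  by move/eqP; rewrite mulf_eq0 (negbTE (mpolyX_neq0 j)) => /eqP.
Qed.

Lemma variables_regular3 (i j l : 'I_n) x : i != l -> j != l ->
  span2 setT ('X_i : RK) 'X_j ('X_l * x) -> span2 setT ('X_i : RK) 'X_j x.
Proof.
move=> il jl [p [q [_ _ e]]]; apply: (@sub_kill _ (pred2 i j)) => [|a u v|m|].
- by exists 0, 0; rewrite !mulr0 addr0.
- move=> [p1 [q1 [_ _ ->]]] [p2 [q2 [_ _ ->]]].
  by exists (a * p1 + p2), (a * q1 + q2); split=> //; ring.
- case/orP => /eqP ->; first by exists 1, 0; split=> //; ring.
  by exists 0, 1; split=> //; ring.
- have := congr1 (kill (pred2 i j)) e;
  rewrite rmorphD !rmorphM /= !killX /= !eqxx orbT !mul0r addr0.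
  rewrite ![l == _]eq_sym (negbTE il) (negbTE jl).
  by move/eqP; rewrite mulf_eq0 (negbTE (mpolyX_neq0 l)) => /eqP.
Qed.

End Variables.

Section SymmetricAlgebra.
Variables (k K : fieldType) (iota : {rmorphism k -> K}) (F : rational_map k).
Variable (Y : 'I_3 -> K).
Hypothesis Y0 : forall i, Y i != 0.

Local Notation R := {mpoly k[3]}.
Local Notation RK := {mpoly K[3]}.
Local Notation f := (tnth (forms F)).
Local Notation ext := (map_mpoly iota : {rmorphism R -> RK}).
Local Notation J := (syzygy_ideal iota F Y).

Let YC i : RK := (Y i)%:MP.

Lemma syzygy_ideal_pihomog m u : J u -> J (pihomog mdeg m u).
Proof.
move=> [s [-> es]]; exists (fun i => pihomog mdeg m (s i)); split.
  by rewrite raddf_sum; apply: eq_bigr => i _; rewrite /= pihomogMC.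
have := congr1 (pihomog mdeg (m + map_degree F)) es.
rewrite raddf_sum raddf0 /= => es'; apply: etrans es'; apply: eq_bigr => i _.
rewrite (pihomogM (d := map_degree F)); last exact/map_mpoly_homog/forms_homog.
by rewrite leq_addl addnK.
Qed.

(** The syzygy ideal is graded, so it contains the component of top degree, which is a nonzero
    constant times [X_t ^ n * h] with [n] the degree of [q]. *)
Lemma syzygy_ideal_power t (q : {poly k}) m h : q != 0 -> h \is m.-homog ->
  J (ext (at_var t q) * h) -> exists n, J ('X_t ^+ n * h).
Proof.
move=> q0 hm; set n := (size q).-1 => Jq; exists n.
have := syzygy_ideal_pihomog (n + m) Jq.
rewrite (pihomogM _ _ hm) leq_addl addnK /= at_var_map at_varE size_map_poly
  raddf_sum /=.
have sq : size q = n.+1 by rewrite /n prednK // lt0n size_poly_eq0.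
have hX i : ('X_t ^+ i : RK) \is i.-homog by rewrite mpolyXn dhomogX;
  apply/eqP; rewrite /= mdegMn mdeg1 mul1n.
have term i : pihomog mdeg n ((map_poly iota q)`_i *: 'X_t ^+ i) = if i == n
  then iota q`_i *: 'X_t ^+ i else 0 :> RK.
  rewrite coef_map linearZ /=; case: eqP => [->|/eqP ne];
    first by rewrite pihomog_dE ?hX.
  by rewrite (pihomog_ne0 _ (hX i)) ?scaler0.
under eq_bigr => i _ do rewrite term.
have nlt : (n < size q)%N by rewrite sq.
rewrite (bigD1 (Ordinal nlt)) //= eqxx big1 ?addr0 => [|i ne]; last first.
  by rewrite -(inj_eq val_inj) /= in ne; rewrite (negbTE ne).
move=> Jn; have lq : iota q`_n != 0 by rewrite fmorph_eq0 -/(lead_coef q) lead_coef_eq0.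
have := syzygy_idealM ((iota q`_n)^-1)%:MP Jn.
by rewrite mul_mpolyC -scalerAl scalerA mulVf // scale1r.
Qed.

(** The colon ideal of the overview, with index 0 in the distinguished place: up to the factor
    [- Y_0], the two generators are the coordinates of the form vector that vanish at the point
    [Y]. *)
Lemma syzygy_idealP u : J u <->
  span2 setT (YC 1 * ext (f 0) - YC 0 * ext (f 1))
    (YC (1 + 1) * ext (f 0) - YC 0 * ext (f (1 + 1))) (u * ext (f 0)).
Proof.
split=> [[s [-> es]]|[p [q [_ _ e]]]].
  exists (s 1), (s (1 + 1)); split=> //; move: es; rewrite !(sum_ord3 0) add0r => es.
  by apply: (lincomb1 (YC 0) es); ring.
have Yu : YC 0 * ((Y 0)^-1)%:MP = 1 by rewrite -rmorphM mulfV ?rmorph1.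
pose r := (u - p * YC 1 - q * YC (1 + 1)) * ((Y 0)^-1)%:MP.
have -> : u = r * YC 0 + p * YC 1 + q * YC (1 + 1).
  by apply: (lincomb1 (- (u - p * YC 1 - q * YC (1 + 1))) Yu); rewrite /r; ring.
apply: syzygy_ideal_sum => //.
by apply: (lincomb2 (((Y 0)^-1)%:MP) (- (p * ext (f 1) + q * ext (f (1 + 1))))
  e Yu); rewrite /r; ring.
Qed.

(** The variables form a regular sequence of length three, so [span2_saturated] applies to the two
    generators, and saturation passes to their colon by [f 0]. *)
Lemma syzygy_ideal_saturated u :
  J ('X_0 * u) -> J ('X_1 * u) -> J ('X_(1 + 1) * u) -> J u.
Proof.
move=> /syzygy_idealP; set a := _ - _; set b := (X in span2 _ _ X) => J0.
move=> /syzygy_idealP J1 /syzygy_idealP J2; apply/syzygy_idealP.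
rewrite -/a -/b in J0 J1 J2 *; rewrite -!mulrA in J0 J1 J2.
have [ab0|] := boolP ((a != 0) || (b != 0)); last first.
  rewrite negb_or !negbK => /andP[/eqP a0 /eqP b0].
  move: J0; rewrite a0 b0 => -[p [q [_ _ /eqP]]].
  rewrite !mul0r addr0 mulf_eq0 (negbTE (mpolyX_neq0 _ _)) => /eqP ->.
  by exists 0, 0; rewrite !mulr0 addr0.
have [a' [b' [e nz rel]]] := relations_free (@factorial_mpoly K 3) ab0.
apply: (@span2_saturated _ setT _ _ _ _ _ _ _ a' b') J0 J1 J2 => //.
- exact: mpolyX_neq0.
- by move=> x y _ _ /variables_regular2 [//|w ->]; exists w.
- by move=> x _; apply: variables_regular3.
- by move=> x y _ _ /rel [w [-> ->]]; exists w.
Qed.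

(* Off the irrelevant ideal the symmetric algebra of a base ideal that is locally
   a complete intersection is its Rees algebra; the irrelevant ideal does not
   matter because [syzygy_ideal] is saturated. *)
Theorem rees_equation e m (H : {mpoly R[3]}) :
  has_height (base_ideal F) 2 -> locally_ci_at_minimal_primes (base_ideal F) ->
  H \is e.-homog -> H.@[f] = 0 -> mmap ext YC H \is m.-homog ->
  J (mmap ext YC H).
Proof.
move=> codimF lciF He Hf Hm; set HY := mmap ext YC H in Hm *.
pose cond : set R := fun c => J (ext c * HY).
have c0 : cond 0 by rewrite /cond rmorph0 mul0r; apply: syzygy_ideal0.
have cD a x y : cond x -> cond y -> cond (a * x + y).
  by rewrite /cond rmorphD rmorphM mulrDl -mulrA; apply: syzygy_idealD.
have cf i : exists n, cond (f i ^+ n) by exists e; apply: conductor_power.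
have pow t : exists n, J ('X_t ^+ n * HY).
  (* Otherwise a prime over [cond] and [I] meets [k[X_t]] only in 0. Outside it there is a [c]
     expressing [c * f l] by the other two forms, yet [c ^+ e] is in [cond]. *)
  have [q q0 cq] : exists2 q : {poly k}, q != 0 & cond (at_var t q).
    apply: contrapT => nq.
    have [q cq|P [PP cP IP Pt]] := exists_minimal_prime (t := t) c0 cD cf.
      by apply/eqP; apply: contrapT => /negP q0; apply: nq; exists q.
    have [l [c [al [be [Pc rel]]]]] := locally_two_generated codimF PP IP Pt lciF.
    have cn0 := not_prime_neq0 PP Pc.
    by apply: Pc; apply: (prime_idealX (n := e) PP); apply: cP;
      apply: conductor_relation rel.
  exact: syzygy_ideal_power q0 Hm cq.
have [n0 J0] := pow 0; have [n1 J1] := pow 1; have [n2 J2] := pow (1 + 1).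
exact: (saturated_powers (@syzygy_idealM _ _ _ _ _) syzygy_ideal_saturated J0 J1 J2).
Qed.

End SymmetricAlgebra.

(** * Linear syzygies and Cremona maps *)

Lemma linear_form_expand (k : fieldType) n (p : {mpoly k[n]}) :
  p \is 1.-homog -> p = \sum_i p@_U_(i) *: 'X_i.
Proof.
move=> p1; apply/mpolyP => m; rewrite raddf_sum /=.
have [/eqP/mdeg1P [i /eqP ->]|m1] := eqVneq (mdeg m) 1%N.
  rewrite (bigD1 i) //= mcoeffZ mcoeffX eqxx mulr1 big1 ?addr0 // => j ji.
  by rewrite mcoeffZ mcoeffXU (negbTE ji) mulr0.
rewrite (dhomog_nemf_coeff p1) // big1 // => i _; rewrite mcoeffZ mcoeffX.
by case: eqP => [e|]; [move: m1; rewrite -e mdeg1 eqxx|rewrite mulr0].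
Qed.

Lemma mmap_map_mpoly (A B T : comNzRingType) n (psi : {rmorphism A -> B})
    (phi : {rmorphism B -> T}) (chi : {rmorphism A -> T}) v (p : {mpoly A[n]}) :
  (forall a, phi (psi a) = chi a) -> mmap phi v (map_mpoly psi p) = mmap chi v p.
Proof.
move=> e; rewrite {1}/map_mpoly.
apply: (@mmap_morph _ _ _ _ (mpolyC n (R := B) \o psi)%FUN chi (mmap phi v)) => [a|i].
  by rewrite /= mmapC; apply: e.
by rewrite /= mmapX mmap1U.
Qed.

Section CrossProduct.
Variable A : comNzRingType.
Implicit Types u v w f : 'I_3 -> A.

Definition cross u v (i : 'I_3) : A := u (i + 1) * v (i + 1 + 1) - u (i + 1 +
  1) * v (i + 1).

Lemma ord3_cycle (i : 'I_3) : i + 1 + 1 + 1 = i.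
Proof. by apply: val_inj; case: i => -[|[|[|//]]] ?. Qed.

Lemma cross_orthl u v : \sum_i u i * cross u v i = 0.
Proof. by rewrite (sum_ord3 0) /cross !ord3_cycle; ring. Qed.

Lemma cross_orthr u v : \sum_i v i * cross u v i = 0.
Proof. by rewrite (sum_ord3 0) /cross !ord3_cycle; ring. Qed.

Lemma cross_proportional u v f : \sum_i u i * f i = 0 -> \sum_i v i * f i = 0 ->
  forall i j, cross u v i * f j = cross u v j * f i.
Proof.
move=> uf vf.
have step i : cross u v i * f (i + 1) = cross u v (i + 1) * f i.
  move: uf vf; rewrite !(sum_ord3 i) => uf vf; rewrite /cross !ord3_cycle.
  by apply: (lincomb2 (v (i + 1 + 1)) (- u (i + 1 + 1)) uf vf); ring.
move=> i j; case: (ord3_cases i j) => -> //.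
by have := step (i + 1 + 1); rewrite ord3_cycle.
Qed.

Lemma cross_eq0 u v : (forall i, cross u v i = 0) -> forall i j, u i * v j = u j * v i.
Proof.
move=> uv0; have e i : u (i + 1) * v (i + 1 + 1) = u (i + 1 + 1) * v (i + 1).
  by apply/eqP; rewrite -subr_eq0; apply/eqP/uv0.
move=> i j; case: (ord3_cases i j) => -> //; first by have := e (i + 1 + 1);
  rewrite !ord3_cycle.
by have := e (i + 1); rewrite !ord3_cycle.
Qed.

End CrossProduct.

Section ProportionalVectors.
Variable k : fieldType.
Local Notation R := {mpoly k[3]}.
Implicit Types s f q : 'I_3 -> R.

(** In lowest terms [q_i / f_i = b / a], and [b * f_j = a * q_j] for all [j]. A prime factor of [a]
    would divide every [f_j], so [a] is a unit. *)
Lemma coprime_multiple f q : (exists i, f i != 0) ->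
  (forall p, prime_elt p -> ~ forall i, divides p (f i)) ->
  (forall i j, q i * f j = q j * f i) -> exists t, forall i, q i = t * f i.
Proof.
move=> [i fi] cop prop; have fR := @factorial_mpoly k 3.
have [g [a [b [ef eq ab]]]] := gcd_split (q i) fR fi.
have /andP[g0 a0] : (g != 0) && (a != 0) by rewrite -negb_or -mulf_eq0 -ef.
have ba : no_common_prime b a by move=> p pP pb pa; apply: (ab p).
have e j : b * f j = a * q j.
  by apply: (mulfI g0); rewrite mulrA -eq prop ef; ring.
have aU : a \is a GRing.unit.
  apply: contrapT => /negP aU; have [p pP pa] := prime_of_nonunit fR a0 aU.
  apply: (cop p pP) => j; apply: divides_trans pa _.
  exact: coprime_divides fR a0 ba (e j).
exists (b / a) => j; rewrite mulrAC e mulrC mulrA mulVr ?mul1r //.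
Qed.

Lemma linear_factor (a e : R) : (a * e) \is 1.-homog -> a * e != 0 ->
  msize a = 1%N /\ msize e = 2%N \/ msize a = 2%N /\ msize e = 1%N.
Proof.
move=> h ae0; have /andP[a0 e0] : (a != 0) && (e != 0) by rewrite -negb_or -mulf_eq0.
have := mlead_supp ae0; move/(dhomog_mf h) => /= m1.
have := mlead_deg ae0; rewrite m1 msizeM //.
have := mpolySpred mdeg a0; have := mpolySpred mdeg e0.
by move: (msize a) (msize e) => x y; lia.
Qed.

(** Proportional vectors are [s = a * e] and [s' = b * e] with [a], [b] coprime. The degree 1 of a
    nonzero entry [a * e_i] goes either to [e], making [a] and [b] constants, or to [a], making [e]
    constant. *)
Lemma proportional_linear_vectors s s' :
  (forall i, s i \is 1.-homog) -> (forall i, s' i \is 1.-homog) ->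
  (forall i j, s i * s' j = s j * s' i) ->
  (exists c c', ((c != 0) || (c' != 0)) /\ forall i, c *: s i = c' *: s' i) \/
  (exists a b (e : 'I_3 -> k), (exists i, e i != 0) /\
     forall i, s i = a * (e i)%:MP /\ s' i = b * (e i)%:MP).
Proof.
move=> s1 s'1 prop; have fR := @factorial_mpoly k 3.
have [[i si]|s0] := pselect (exists i, s i != 0); last first.
  left; exists 1, 0; rewrite oner_neq0; split=> // i; rewrite scale1r scale0r.
  by apply/eqP; apply: contrapT => /negP si; apply: s0; exists i.
have [g [a [b [ea eb ab]]]] := gcd_split (s' i) fR si.
have /andP[g0 a0] : (g != 0) && (a != 0) by rewrite -negb_or -mulf_eq0 -ea.
have ba : no_common_prime b a by move=> p pP pb pa; apply: (ab p).
have rel j : b * s j = a * s' j.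
  by apply: (mulfI g0); rewrite !mulrA -ea -eb prop mulrC.
have [e eE] := choice (fun j => coprime_divides fR a0 ba (rel j)).
have eE' j : s' j = b * e j.
  by apply: (mulfI a0); rewrite -rel eE; ring.
have ai : (a * e i) \is 1.-homog by rewrite -eE.
have ai0 : a * e i != 0 by rewrite -eE.
have cst (p : R) : p = 0 \/ msize p = 1%N -> p = (p@_0)%:MP.
  by move=> [->|/eq_leq/msize1_polyC //]; rewrite mcoeff0 mpolyC0.
have [[a1 e2]|[a2 e1]] := linear_factor ai ai0.
  left; exists b@_0, a@_0; split.
    by rewrite -[a@_0 == 0](mpolyC_eq0 3) -cst ?a0 ?orbT //; right.
  move=> j; rewrite -!mul_mpolyC -!cst ?rel //; first by right.
  have [->|b0] := eqVneq b 0; [by left|right].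
  have ei0 : e i != 0 by rewrite -msize_poly_eq0 e2.
  have bi : (b * e i) \is 1.-homog by rewrite -eE'.
  by have [[]|[_]] := linear_factor bi (mulf_neq0 b0 ei0); rewrite ?e2.
have ec j : e j = ((e j)@_0)%:MP.
  apply: cst; have [->|ej0] := eqVneq (e j) 0; [by left|right].
  have aj : (a * e j) \is 1.-homog by rewrite -eE.
  by have [[]|[]] := linear_factor aj (mulf_neq0 a0 ej0); rewrite ?a2.
right; exists a, b, (fun j => (e j)@_0); split.
  by exists i; rewrite -(mpolyC_eq0 3) -ec -msize_poly_eq0 e1.
by move=> j; rewrite -ec.
Qed.

End ProportionalVectors.

(** The relations are the kernel of the matrix of coefficients, which has entries in [k]; its kernel
    over [K] is spanned by its kernel over [k]. *)
Lemma relations_descend (k K : fieldType) (iota : {rmorphism k -> K}) n (S : finType)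
    (v : S -> {mpoly k[n]}) (l : S -> K) :
  \sum_s l s *: map_mpoly iota (v s) = 0 ->
  exists r (B : 'I_r -> S -> k) (mu : 'I_r -> K),
    (forall i, \sum_s B i s *: v s = 0) /\
    forall s, l s = \sum_i mu i * iota (B i s).
Proof.
move=> rel; pose d := \max_s msize (v s).
have vd s : (msize (v s) <= d)%N by apply: leq_bigmax.
pose A : 'M_(#|S|, #|{: 'X_{1..n < d}}|) :=
  \matrix_(i, j) (v (enum_val i))@_(enum_val j : 'X_{1..n < d}).
have reindexS (V : nmodType) (G : S -> V) : \sum_s G s = \sum_(i < #|S|) G (enum_val i).
  rewrite (reindex (@enum_val S predT)) //=.
  by exists enum_rank => x _; rewrite ?enum_valK ?enum_rankK.
pose lr : 'rV_#|S| := \row_i l (enum_val i).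
have : (lr <= kermx (map_mx iota A))%MS.
  apply/sub_kermxP/rowP => j; rewrite !mxE.
  have := congr1 (mcoeff (enum_val j : 'X_{1..n < d})) rel; rewrite mcoeff0 => {}rel.
  apply: etrans rel; rewrite raddf_sum reindexS; apply: eq_bigr => i _ /=.
  by rewrite !mxE mcoeffZ mcoeff_map_mpoly.
rewrite -map_kermx => /submxP [D eD].
exists #|S|, (fun i s => kermx A i (enum_rank s)), (fun i => D 0 i);
  split=> [i|s]; last first.
  have := congr1 (fun u : 'rV_#|S| => u 0 (enum_rank s)) eD;
    rewrite !mxE enum_rankK => ->.
  by apply: eq_bigr => i _; rewrite mxE.
apply/mpolyP => m; rewrite mcoeff0 raddf_sum /=.
have [md|md] := ltnP (mdeg m) d; last first.
  rewrite big1 // => s _; rewrite mcoeffZ memN_msupp_eq0 ?mulr0 //.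
  by apply: msize_mdeg_ge; apply: leq_trans md.
have := congr1 (fun B : 'M_(_, _) => B i (enum_rank (BMultinom md))) (mulmx_ker A).
rewrite !mxE => e; apply: etrans e; rewrite reindexS; apply: eq_bigr => j _.
by rewrite mcoeffZ enum_valK !mxE enum_rankK.
Qed.

(* Stated over an abstract coefficient ring [A]: unification is too slow when
   [A] is itself a polynomial ring. *)
Section ScaledDifference.
Variables (k A B : comNzRingType) (n : nat) (psi : {rmorphism k -> A}).
Variables (a b : A) (p q : {mpoly k[n]}).

Definition scaled_difference : {mpoly A[n]} :=
  a *: map_mpoly psi p - b *: map_mpoly psi q.

Lemma meval_scaled_difference v :
  mmap psi v p * a = mmap psi v q * b -> scaled_difference.@[v] = 0.
Proof.
move=> e; rewrite mevalB !mevalZ /meval !(@mmap_map_mpoly _ _ _ _ psi idfun psi) //.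
by rewrite mulrC e mulrC subrr.
Qed.

Lemma mmap_scaled_difference (phi : {rmorphism A -> B}) v p' q' :
  mmap phi v (map_mpoly psi p) = p' -> mmap phi v (map_mpoly psi q) = q' ->
  mmap phi v scaled_difference = p' * phi a - q' * phi b.
Proof. by move=> <- <-; rewrite mmapB !mmapZ; congr (_ - _); rewrite mulrC. Qed.

Lemma scaled_difference_homog d : p \is d.-homog -> q \is d.-homog ->
  scaled_difference \is d.-homog.
Proof. by move=> pd qd; apply: rpredB; apply: dhomogZ; apply: map_mpoly_homog. Qed.

End ScaledDifference.

(** * Syzygies over the generic point *)

Section GenericPoint.
Variables (k : fieldType) (F : rational_map k).
Hypotheses (codimF : has_height (base_ideal F) 2)
  (lciF : locally_ci_at_minimal_primes (base_ideal F)).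

Local Notation R := {mpoly k[3]}.
Local Notation K := {fraction {mpoly k[3]}}.
Local Notation f := (tnth (forms F)).

(** The fractions play the role of functions of [y]; the variables of polynomials over this field
    are the [x]. *)
Definition generic_embedding : {rmorphism k -> {fraction {mpoly k[3]}}} :=
  (@tofrac R \o @mpolyC 3 k)%FUN.

Definition generic_point (i : 'I_3) : {fraction {mpoly k[3]}} := tofrac ('X_i : R).

Local Notation ext := (map_mpoly generic_embedding).
Local Notation J := (syzygy_ideal generic_embedding F generic_point).

Lemma generic_point_neq0 i : generic_point i != 0.
Proof. by rewrite tofrac_eq0 mpolyX_neq0. Qed.

Lemma generic_eval (Q : R) : mmap generic_embedding generic_point Q = tofrac Q.
Proof.
rewrite -(@mmap_morph _ _ _ _ (@mpolyC 3 k) generic_embedding (@tofrac R) (fun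
  i => 'X_i)) //.
rewrite -[in RHS](comp_mpoly_id Q) /comp_mpoly; congr (tofrac _).
rewrite /mmap; apply: eq_bigr => m _; congr (_ * _); rewrite /mmap1;
  apply: eq_bigr => i _.
by rewrite tnth_mktuple.
Qed.

Lemma generic_eval_const (Q : R) :
  mmap ext (fun i => (generic_point i)%:MP) (map_mpoly (@mpolyC 3 k) Q) =
  (tofrac Q)%:MP_[3].
Proof.
rewrite (@mmap_map_mpoly _ _ _ _ _ _ (@mpolyC 3 K \o generic_embedding)%FUN) => [|a].
  by rewrite -generic_eval; apply/esym; apply: mmap_morph.
exact: map_mpolyC.
Qed.

Lemma meval_const (Q : R) : (map_mpoly (@mpolyC 3 k) Q).@[f] = Q \mPo forms F.
Proof. exact: mmap_map_mpoly. Qed.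

(** The value of [Q] at the generic point is [Q] itself, a nonzero constant of [K], and
    [rees_equation] puts it in the syzygy ideal. *)
Lemma form_relation_generic e (Q : R) : Q \is e.-homog -> Q \mPo forms F = 0 ->
  Q != 0 -> J 1.
Proof.
move=> Qe Qf Q0.
have JQ : J (tofrac Q)%:MP.
  rewrite -generic_eval_const.
  apply: (rees_equation generic_point_neq0 codimF lciF (m := 0%N)
    (map_mpoly_homog _ Qe)).
    by rewrite meval_const.
  have := generic_eval_const Q => /= ->.
  by rewrite -[_%:MP]mulr1 mul_mpolyC; apply: dhomogZ; apply: dhomog1.
have tQ0 : tofrac Q != 0 by rewrite tofrac_eq0.
have -> : 1 = ((tofrac Q)^-1)%:MP * (tofrac Q)%:MP :> {mpoly K[3]}.
  by rewrite -rmorphM mulVf ?rmorph1.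
exact: syzygy_idealM.
Qed.

Lemma inverse_generic (G : rational_map k) i j : comp_is_id G F ->
  J ((tofrac (tnth (forms G) j))%:MP * 'X_i - (tofrac (tnth (forms G) i))%:MP * 'X_j).
Proof.
move=> [_ GF]; pose g i := tnth (forms G) i.
pose H : {mpoly R[3]} := scaled_difference (@mpolyC 3 k) 'X_i 'X_j (g j) (g i).
have He : H \is (map_degree G).-homog.
  by apply: scaled_difference_homog; apply: forms_homog.
have Hf : H.@[f] = 0 by apply: meval_scaled_difference; apply: GF.
have HY : mmap ext (fun i => (generic_point i)%:MP) H =
    (tofrac (g j))%:MP * 'X_i - (tofrac (g i))%:MP * 'X_j.
  apply: etrans (mmap_scaled_difference _ _ (generic_eval_const _)
    (generic_eval_const _)) _.
  by congr (_ * _ - _ * _); apply: map_mpolyX.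
rewrite -/(g i) -/(g j) -HY.
apply: (rees_equation generic_point_neq0 codimF lciF (m := 1%N) He Hf); rewrite HY.
by apply: rpredB; rewrite mul_mpolyC; apply: dhomogZ; rewrite dhomogX; apply/eqP/mdeg1.
Qed.

(** The components of degree 1 of a syzygy giving [u] suffice. Their coefficients form a [K]-linear
    relation between the nine products of a form (index [mn.1]) and a variable (index [mn.2]). *)
Lemma linear_syzygy_generic (u : {mpoly K[3]}) : u \is 1.-homog -> J u ->
  exists l : 'I_3 * 'I_3 -> K,
    u = \sum_mn (l mn * generic_point mn.1) *: 'X_mn.2 /\
    \sum_mn l mn *: ext ('X_mn.2 * f mn.1) = 0.
Proof.
move=> u1 [s [es sf]].
have u1E := pihomog_dE u1; rewrite es raddf_sum /= in u1E.
pose s1 m := pihomog mdeg 1 (s m).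
have s1E m : s1 m = \sum_n (s1 m)@_U_(n) *: 'X_n.
  by apply: linear_form_expand; apply: pihomogP.
have sf1 : \sum_m s1 m * ext (f m) = 0.
  have := congr1 (pihomog mdeg (1 + map_degree F)) sf; rewrite raddf_sum raddf0 /= => e.
  apply: etrans e; apply: eq_bigr => m _.
  rewrite (pihomogM (d := map_degree F)); last exact/map_mpoly_homog/forms_homog.
  by rewrite leq_addl addnK.
exists (fun mn => (s1 mn.1)@_U_(mn.2)); split.
  rewrite es -u1E -(pair_bigA _ (fun m n => ((s1 m)@_U_(n) * generic_point m)
    *: 'X_n)) /=.
  apply: eq_bigr => m _; rewrite pihomogMC -/(s1 m) [in LHS]s1E mulr_suml.
  by apply: eq_bigr => n _; rewrite mulrC mul_mpolyC scalerA mulrC.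
apply: etrans sf1; rewrite -(pair_bigA _ (fun m n => (s1 m)@_U_(n) *: ext ('X_n
  * f m))) /=.
apply: eq_bigr => m _; rewrite [in RHS]s1E mulr_suml; apply: eq_bigr => n _.
by rewrite rmorphM /= -scalerAl; congr (_ *: (_ * _)); apply: map_mpolyX.
Qed.

End GenericPoint.

Section CremonaSyzygies.
Variables (k : fieldType) (F : rational_map k).
Hypotheses (codimF : has_height (base_ideal F) 2)
  (lciF : locally_ci_at_minimal_primes (base_ideal F)).

Local Notation R := {mpoly k[3]}.
Local Notation K := {fraction {mpoly k[3]}}.
Local Notation f := (tnth (forms F)).
Local Notation iota := (generic_embedding k).

(** The two linear forms [u] obtained from the inverse are independent over [K]. Both come from
    relations over [k] by extension of scalars; were these all multiples of a single one, both [u]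
    would be multiples of the one form [w]. *)
Lemma cremona_relations (G : rational_map k) : comp_is_id G F ->
  exists b b' : 'I_3 * 'I_3 -> k,
  [/\ \sum_mn b mn *: ('X_mn.2 * f mn.1) = 0,
      \sum_mn b' mn *: ('X_mn.2 * f mn.1) = 0
    & forall c c', (forall mn, c * b mn = c' * b' mn) -> c = 0 /\ c' = 0].
Proof.
move=> GF; have [j g0] := forms_neq0 G.
pose ga i : K := tofrac (tnth (forms G) i).
have gaj : ga j != 0 by rewrite tofrac_eq0.
pose u i : {mpoly K[3]} := (ga j)%:MP * 'X_i - (ga i)%:MP * 'X_j.
have u1 i : u i \is 1.-homog.
  by apply: rpredB; rewrite mul_mpolyC; apply: dhomogZ; rewrite dhomogX;
    apply/eqP/mdeg1.
have Ju i := inverse_generic codimF lciF i j GF.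
have ne1 : (j == j + 1) = false by case: (j) => -[|[|[|//]]] ?.
have ne2 : (j == j + 1 + 1) = false by case: (j) => -[|[|[|//]]] ?.
have ne3 : (j + 1 == j + 1 + 1) = false by case: (j) => -[|[|[|//]]] ?.
have uE i m : (u i)@_U_(m) = ga j * (i == m)%:R - ga i * (j == m)%:R.
  by rewrite mcoeffB !mcoeffCM !mcoeffXU.
have [l1 [eu1 rel1]] := linear_syzygy_generic (u1 (j + 1)) (Ju (j + 1)).
have [l2 [eu2 rel2]] := linear_syzygy_generic (u1 (j + 1 + 1)) (Ju (j + 1 + 1)).
have [r1 [B1 [mu1 [B1P e1]]]] := relations_descend rel1.
have [r2 [B2 [mu2 [B2P e2]]]] := relations_descend rel2.
apply: contrapT => nind.
pose Rel (b : 'I_3 * 'I_3 -> k) := \sum_mn b mn *: ('X_mn.2 * f mn.1) = 0.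
have dep b b' : Rel b -> Rel b' ->
    exists c c', ((c != 0) || (c' != 0)) /\ forall mn, c * b mn = c' * b' mn.
  move=> Rb Rb'; apply: contrapT => H; apply: nind; exists b, b'; split=> // c c' e.
  split; apply/eqP; apply: contrapT => /negP c0; apply: H; exists c, c';
    rewrite c0 ?orbT //.
have [i0 [mn0 b0]] : exists i mn, B1 i mn != 0.
  apply: contrapT => H; have : u (j + 1) = 0.
    rewrite eu1 big1 // => mn _; rewrite e1 big1 ?mul0r ?scale0r // => i _.
    suff -> : B1 i mn = 0 by rewrite rmorph0 mulr0.
    by apply/eqP; apply: contrapT => /negP ?; apply: H; exists i, mn.
  move/(congr1 (mcoeff U_(j + 1))); rewrite uE ne1 eqxx mcoeff0 mulr1 mulr0 subr0.
  by move/eqP; rewrite (negbTE gaj).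
have mult b : Rel b -> exists c, forall mn, b mn = c * B1 i0 mn.
  move=> Rb; have [c [c' [nz e]]] := dep _ _ Rb (B1P i0).
  have c0 : c != 0.
    apply: contraTneq nz => c0; rewrite c0 eqxx /= negbK.
    by have := e mn0; rewrite c0 mul0r => /esym/eqP; rewrite mulf_eq0 (negbTE b0) orbF.
  by exists (c' / c) => mn; apply: (mulfI c0); rewrite e mulrA mulrCA mulfV ?mulr1.
pose w := \sum_mn (iota (B1 i0 mn) * generic_point k mn.1) *: 'X_mn.2 : {mpoly K[3]}.
have prop (r : nat) (B : 'I_r -> 'I_3 * 'I_3 -> k) (mu : 'I_r -> K) l x :
    (forall i, Rel (B i)) -> (forall mn, l mn = \sum_i mu i * iota (B i mn)) ->
    x = \sum_mn (l mn * generic_point k mn.1) *: 'X_mn.2 -> exists c : K, x = c *: w.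
  move=> RB el ->; have [c ce] := choice (fun i => mult _ (RB i)).
  exists (\sum_i mu i * iota (c i)); rewrite /w scaler_sumr; apply: eq_bigr => mn _.
  rewrite scalerA mulrA; congr ((_ * _) *: _); rewrite el mulr_suml;
    apply: eq_bigr => i _.
  by rewrite ce rmorphM mulrA.
have [c1 ec1] := prop _ _ _ _ _ B1P e1 eu1.
have [c2 ec2] := prop _ _ _ _ _ B2P e2 eu2.
have e12 : c2 *: u (j + 1) = c1 *: u (j + 1 + 1).
  by rewrite -/(u _) in ec1 ec2; rewrite ec1 ec2 !scalerA mulrC.
(* The variable of index [j + 1] occurs in [u (j + 1)], with coefficient [ga j], but not in
   [u (j + 1 + 1)]. *)
have c20 : c2 = 0.
  have := congr1 (mcoeff U_(j + 1)) e12; rewrite !mcoeffZ !uE eqxx ne1.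
  rewrite [_ + 1 == _]eq_sym ne3 !mulr0 !subr0 mulr1 mulr0 => /eqP.
  by rewrite mulf_eq0 (negbTE gaj) orbF => /eqP.
have : u (j + 1 + 1) = 0 by rewrite -/(u _) in ec2; rewrite ec2 c20 scale0r.
move/(congr1 (mcoeff U_(j + 1 + 1))); rewrite uE ne2 eqxx mcoeff0 mulr1 mulr0 subr0.
by move/eqP; rewrite (negbTE gaj).
Qed.

(** Composition with [G] turns the forms into a common multiple of the variables, which are linearly
    independent. *)
Lemma cremona_forms_free (G : rational_map k) (c : 'I_3 -> k) : comp_is_id F G ->
  \sum_i c i *: f i = 0 -> forall i, c i = 0.
Proof.
move=> [[i0 h0] hX] rel i.
pose h i := f i \mPo forms G.
have : \sum_i c i *: h i = 0.
  have := congr1 (comp_mpoly (forms G)) rel; rewrite rmorph_sum rmorph0 => e.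
  apply: etrans e; apply: eq_bigr => m _; exact/esym/comp_mpolyZ.
move/(congr1 ( *%R^~ ('X_i0 : R))); rewrite mul0r mulr_suml.
under eq_bigr => m _ do rewrite -scalerAl hX scalerAr.
rewrite -mulr_sumr => /eqP; rewrite mulf_eq0 (negbTE h0) /= => /eqP e.
have := congr1 (mcoeff U_(i)) e;
  rewrite mcoeff0 raddf_sum (bigD1 i) //= mcoeffZ mcoeffXU eqxx.
rewrite mulr1 big1 ?addr0 // => m /negbTE mi; by rewrite mcoeffZ mcoeffXU mi mulr0.
Qed.

End CremonaSyzygies.

Lemma kill_prime_ideal (k : fieldType) n (S : pred 'I_n) :
  prime_ideal [set p : {mpoly k[n]} | kill S p = 0]%classic.
Proof.
split=> /= [||a x y ex ey|x y].
- exact: rmorph0.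
- by rewrite rmorph1; apply/eqP/oner_neq0.
- by rewrite rmorphD rmorphM /= ex ey mulr0 addr0.
- by rewrite rmorphM => /eqP; rewrite mulf_eq0 => /orP[]/eqP; [left|right].
Qed.

(** The chain consists of the ideals of the first [j] variables for [j < n], with [P] itself on
    top. *)
Lemma variables_prime_chain (k : fieldType) n (P : set {mpoly k[n]}) :
  prime_ideal P -> (forall i, P 'X_i) -> prime_chain P n.
Proof.
move=> PP PX; pose S j : pred 'I_n := fun i => (i < j)%N.
pose C j : set {mpoly k[n]} :=
  if (j < n)%N then [set p | kill (S j) p = 0]%classic else P.
have CP j : prime_ideal (C j) by rewrite /C; case: ifP => // _; apply: kill_prime_ideal.
have CX j (i : 'I_n) : (i < j)%N -> C j 'X_i.
  by rewrite /C; case: ifP => //= _ ij; rewrite killX /S ij.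
exists C; split=> // [j jn|]; last by rewrite /C ltnn.
split=> [p|H].
  rewrite {1}/C jn /=; have [C0 _ CD _] := CP j.+1.
  by apply: sub_kill => // i ij; apply: CX; apply: ltnW.
have := H 'X_(Ordinal jn) (CX j.+1 (Ordinal jn) (ltnSn _)).
by rewrite /C jn /= killX /S /= ltnn; apply/eqP/mpolyX_neq0.
Qed.

(** The cyclic order in [cross] reverses the rows when the middle one is deleted, while the other
    two minors contain the middle row. With this sign all three therefore change sign alike. *)
Definition middle_sign (A : comNzRingType) (i : 'I_3) : A := if i == 1 then - 1 else 1.

Lemma cross_columns (A : comNzRingType) (M : 'M[A]_(3, 2)) i :
  cross (fun i => middle_sign A i * M i 0) (fun i => middle_sign A i * M i 1) i =
  - \det (row' i M).
Proof.
rewrite (expand_det_row _ 0) !big_ord_recl big_ord0 /cofactor !det_mx11 !mxE /=.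
have -> : lift 0 0 = 1 :> 'I_2 by apply: val_inj.
have -> : lift 1 0 = 0 :> 'I_2 by apply: val_inj.
rewrite addr0 expr0 expr1 mul1r mulN1r /cross.
case: i => -[|[|[|//]]] ilt; rewrite /middle_sign /=.
- have -> : lift (Ordinal ilt) 0 = Ordinal ilt + 1 by apply: val_inj.
  have -> : lift (Ordinal ilt) 1 = Ordinal ilt + 1 + 1 by apply: val_inj.
  ring.
- have -> : lift (Ordinal ilt) 0 = Ordinal ilt + 1 + 1 by apply: val_inj.
  have -> : lift (Ordinal ilt) 1 = Ordinal ilt + 1 by apply: val_inj.
  ring.
- have -> : lift (Ordinal ilt) 0 = Ordinal ilt + 1 by apply: val_inj.
  have -> : lift (Ordinal ilt) 1 = Ordinal ilt + 1 + 1 by apply: val_inj.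
  ring.
Qed.

(** * From a Cremona map to the matrix *)

Section Forward.
Variables (k : fieldType) (F : rational_map k).
Hypotheses (codimF : has_height (base_ideal F) 2)
  (lciF : locally_ci_at_minimal_primes (base_ideal F)).

Local Notation R := {mpoly k[3]}.
Local Notation f := (tnth (forms F)).
Local Notation I := (base_ideal F).

Lemma base_variables : ~ forall i, I 'X_i.
Proof.
move=> IX; have [_ [P [PP IP]]] := codimF; apply.
by apply: variables_prime_chain => // i; apply: IP.
Qed.

Lemma free_linear_forms_base :
  (forall i, f i \is 1.-homog) ->
  (forall c : 'I_3 -> k, \sum_i c i *: f i = 0 -> forall i, c i = 0) ->
  forall i, I 'X_i.
Proof.
move=> f1 free i; pose A : 'M_3 := \matrix_(m, n) (f m)@_U_(n).
have fE m : f m = \sum_n A m n *: 'X_n.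
  by rewrite [LHS](linear_form_expand (f1 m)); apply: eq_bigr => n _; rewrite mxE.
have AU : A \in unitmx.
  rewrite -row_free_unit -kermx_eq0; apply/rowV0P => c /sub_kermxP cA.
  apply/rowP => m; rewrite mxE; apply: (free (fun m => c 0 m)).
  under eq_bigr => j _ do rewrite fE scaler_sumr.
  rewrite exchange_big big1 //= => n _.
  under eq_bigr => j _ do rewrite scalerA.
  rewrite -scaler_suml; have := congr1 (fun B : 'rV_3 => B 0 n) cA.
  by rewrite !mxE => ->; rewrite scale0r.
exists (fun m => ((invmx A) i m)%:MP).
under eq_bigr => m _ do rewrite mul_mpolyC fE scaler_sumr.
rewrite exchange_big (bigD1 i) //=.
have AE n : \sum_m invmx A i m *: (A m n *: 'X_n : R) = (i == n)%:R *: 'X_n.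
  under eq_bigr => m _ do rewrite scalerA.
  rewrite -scaler_suml; congr (_ *: _).
  by have := congr1 (fun B : 'M_3 => B i n) (mulVmx AU); rewrite !mxE.
rewrite AE eqxx scale1r big1 ?addr0 // => n ni.
by rewrite AE eq_sym (negbTE ni) scale0r.
Qed.

Lemma cross_homog (s s' : 'I_3 -> R) d d' : (forall i, s i \is d.-homog) ->
  (forall i, s' i \is d'.-homog) -> forall i, cross s s' i \is (d + d').-homog.
Proof. by move=> sd sd' i; apply: rpredB; apply: dhomogM. Qed.

Lemma minors_of_syzygies (s s' : 'I_3 -> R) (c : k) : c != 0 ->
  (forall i, s i \is 1.-homog) -> (forall i, s' i \is 1.-homog) ->
  (forall i, f i = c *: cross s s' i) ->
  exists M : 'M[R]_(3, 2), (forall i j, M i j \is 1.-homog) /\ defined_by_minors F M.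
Proof.
move=> c0 s1 s'1 fE.
pose sg := middle_sign R.
have sgM p i : sg i * (sg i * p) = p by rewrite /sg /middle_sign; case: ifP => _; ring.
pose M : 'M[R]_(3, 2) := \matrix_(i, j) (sg i * (if j == 0 then s i else s' i)).
exists M; split=> [i j|].
  rewrite mxE /sg /middle_sign; case: ifP => _;
    rewrite ?mulN1r ?dhomogN ?mul1r; by case: ifP.
exists (- c) => [|i]; first by rewrite oppr_eq0.
rewrite fE scaleNr -scalerN; congr (_ *: _); rewrite -cross_columns.
by rewrite /cross !mxE /= !sgM.
Qed.

Theorem cremona_minors : is_cremona F ->
  exists M : 'M[R]_(3, 2), (forall i j, M i j \is 1.-homog) /\ defined_by_minors F M.
Proof.
move=> [G [GF FG]].
have [b [b' [rb rb' ind]]] := cremona_relations codimF lciF GF.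
have free c : \sum_i c i *: f i = 0 -> forall i, c i = 0 := cremona_forms_free FG.
pose lin (b : 'I_3 * 'I_3 -> k) m : R := \sum_n b (m, n) *: 'X_n.
have linX c m n : (lin c m)@_U_(n) = c (m, n).
  rewrite raddf_sum (bigD1 n) //= mcoeffZ mcoeffXU eqxx mulr1 big1 ?addr0 // =>
    n' /negbTE nn.
  by rewrite mcoeffZ mcoeffXU nn mulr0.
have lin1 c m : lin c m \is 1.-homog.
  by apply: rpred_sum => n _; apply: dhomogZ; rewrite dhomogX; apply/eqP/mdeg1.
have linS c : \sum_mn c mn *: ('X_mn.2 * f mn.1) = 0 -> \sum_m lin c m * f m = 0.
  move=> rc; apply: etrans rc; transitivity (\sum_m \sum_n c (m, n) *: ('X_n * f m)).
    by apply: eq_bigr => m _; rewrite mulr_suml; apply: eq_bigr => n _;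
      rewrite scalerAl.
  by rewrite pair_bigA; apply: eq_bigr => -[].
pose s := lin b; pose s' := lin b'.
have sf := linS b rb; have s'f := linS b' rb'.
pose q := cross s s'.
have [t qt] : exists t, forall i, q i = t * f i.
  apply: coprime_multiple (forms_neq0 F) (forms_coprime codimF) _.
  exact: cross_proportional.
have q2 i : q i \is 2.-homog by apply: (@cross_homog s s' 1 1) => j; apply: lin1.
(* If the cross product vanished, the two syzygies would be dependent over [k], or a constant vector
   [e] would be a syzygy; the first contradicts [ind], the second [free]. *)
have t0 : t != 0.
  apply/eqP => t0.
  have q0 : forall i j, s i * s' j = s j * s' i.
    by apply: cross_eq0 => i; apply: etrans (qt i) _; rewrite t0 mul0r.
  have [[c [c' [nz e]]]|[a [a' [e [[i ei] ae]]]]] :=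
    proportional_linear_vectors (lin1 b) (lin1 b') q0.
    have [] := ind c c'.
      move=> [m n]; have := congr1 (mcoeff U_(n)) (e m).
      by rewrite !mcoeffZ !linX.
    by move=> c0 c'0; move: nz; rewrite c0 c'0 eqxx.
  have a0 : a != 0.
    apply: contraTneq isT => a0; have [|+ _] := ind 1 0; last by move/eqP;
      rewrite oner_eq0.
    move=> [m n]; have [em _] := ae m; have := congr1 (mcoeff U_(n)) em;
      by rewrite a0 mul0r mcoeff0 linX mul0r => ->; rewrite mulr0.
  case/eqP: ei; apply: free; apply: (mulfI a0); rewrite mulr0 mulr_sumr;
    apply: etrans sf.
  by apply: eq_bigr => m _; have [-> _] := ae m; rewrite -mul_mpolyC mulrA.
have [i fi] := forms_neq0 F.
have qi : q i != 0 by rewrite qt mulf_neq0.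
have msf j : f j != 0 -> msize (f j) = (map_degree F).+1.
  move=> fj; rewrite -mlead_deg //; congr _.+1.
  exact: (dhomog_mf (forms_homog F j)) (mlead_supp fj).
have msq : msize (q i) = 3.
  rewrite -mlead_deg //; congr _.+1; exact: (dhomog_mf (q2 i)) (mlead_supp qi).
(* [msize] is the degree plus one: the degrees of [t] and [F] add up to 2. Degree 0 puts a unit in
   the base ideal, degree 1 makes it contain all variables, so [F] has degree 2 and [t] is
   constant. *)
have sz : (msize t + map_degree F)%N = 3.
  by move: msq; rewrite qt msizeM // msf // addnS.
have t1 := mpolySpred mdeg t0.
have [d0|d0] := posnP (map_degree F).
  have fU : f i \is a GRing.unit.
    have := msf i fi; rewrite d0 => /eq_leq/msize1_polyC e.
    rewrite e; apply: (rmorph_unit (@mpolyC 3 k)); rewrite unitfE.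
    by move: fi; rewrite {1}e mpolyC_eq0.
  by case: (unit_notin_base codimF fU); apply: form_in_base.
have [d1|d1] := eqVneq (map_degree F) 1%N.
  case: base_variables; apply: free_linear_forms_base => // j.
  by have := forms_homog F j; rewrite d1.
have tc : t = (t@_0)%:MP by apply: msize1_polyC; lia.
have tc0 : t@_0 != 0 by move: t0; rewrite {1}tc mpolyC_eq0.
apply: (@minors_of_syzygies s s' (t@_0)^-1).
- by rewrite invr_eq0.
- exact: lin1.
- exact: lin1.
move=> j; have -> : cross s s' j = t * f j := qt j.
move: tc tc0; move: (t@_0) => c -> c0.
by rewrite mul_mpolyC scalerA mulVf ?scale1r.
Qed.

End Forward.

Section BilinearForms.
Variable k : fieldType.
Local Notation R := {mpoly k[3]}.
Implicit Types (a b : 'I_3 -> 'I_3 -> k) (v : 3.-tuple R).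

Definition linear_forms a i : R := \sum_n a i n *: 'X_n.

Definition transpose a i j := a j i.

Lemma linear_forms_homog a i : linear_forms a i \is 1.-homog.
Proof. by apply: rpred_sum => n _; apply: dhomogZ; rewrite dhomogX;
  apply/eqP/mdeg1. Qed.

Lemma mcoeff_linear_forms a i n : (linear_forms a i)@_U_(n) = a i n.
Proof.
rewrite raddf_sum (bigD1 n) //= mcoeffZ mcoeffXU eqxx mulr1 big1 ?addr0 // =>
  n' /negbTE nn.
by rewrite mcoeffZ mcoeffXU nn mulr0.
Qed.

Lemma comp_linear_forms a i v : linear_forms a i \mPo v = \sum_n a i n *: tnth v n.
Proof.
rewrite /linear_forms rmorph_sum; apply: eq_bigr => n _.
by rewrite /= comp_mpolyZ comp_mpolyXU -tnth_nth.
Qed.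

(** The identity [s(x) . y = x . n(y)] of the overview at [y = v]: both sides are the bilinear form
    with coefficients [a]. *)
Lemma bilinear_swap a v :
  \sum_n (linear_forms (transpose a) n \mPo v) * 'X_n = \sum_i linear_forms a i
    * tnth v i.
Proof.
under eq_bigr => n _ do rewrite comp_linear_forms mulr_suml.
rewrite exchange_big; apply: eq_bigr => i _; rewrite mulr_suml.
by apply: eq_bigr => n _; rewrite -!scalerAl mulrC.
Qed.

Lemma comp_cross (u w : 'I_3 -> R) v i :
  cross u w i \mPo v = cross (fun j => u j \mPo v) (fun j => w j \mPo v) i.
Proof. by rewrite /cross rmorphB !rmorphM. Qed.

End BilinearForms.

(** * From the matrix to a Cremona map *)

Section Backward.
Variables (k : fieldType) (F : rational_map k).
Hypotheses (codimF : has_height (base_ideal F) 2)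
  (lciF : locally_ci_at_minimal_primes (base_ideal F)).

Local Notation R := {mpoly k[3]}.
Local Notation K := {fraction {mpoly k[3]}}.
Local Notation f := (tnth (forms F)).
Local Notation J := (syzygy_ideal (generic_embedding k) F (generic_point k)).

(** The components of degree 0 of a syzygy with value 1 form a nonzero constant syzygy over [K],
    which descends to [k]. *)
Lemma unit_syzygy_dependent : J 1 ->
  exists b : 'I_3 -> k, (exists i, b i != 0) /\ \sum_i b i *: f i = 0.
Proof.
move=> [s [es sf]].
pose s0 i := pihomog mdeg 0 (s i).
have s0c i : s0 i = ((s0 i)@_0)%:MP.
  have [->|nz] := eqVneq (s0 i) 0; first by rewrite mcoeff0 mpolyC0.
  apply: msize1_polyC; rewrite -mlead_deg //.
  by have -> : mdeg (mlead (s0 i)) = 0%N := dhomog_mf (pihomogP _ _ _) (mlead_supp nz).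
have rel : \sum_i (s0 i)@_0 *: map_mpoly (generic_embedding k) (f i) = 0.
  have := congr1 (pihomog mdeg (0 + map_degree F)) sf; rewrite raddf_sum raddf0 /= => e.
  apply: etrans e; apply: eq_bigr => m _.
  rewrite (pihomogM (d := map_degree F)); last exact/map_mpoly_homog/forms_homog.
  by rewrite leq_addl addnK -/(s0 m) [in RHS]s0c mul_mpolyC.
have [r [B [mu [BP eB]]]] := relations_descend rel.
have [j [i nz]] : exists j i, B j i != 0.
  apply: contrapT => H; have s00 i : s0 i = 0.
    rewrite s0c eB big1 ?mpolyC0 // => j _.
    suff -> : B j i = 0 by rewrite rmorph0 mulr0.
    by apply/eqP; apply: contrapT => /negP ?; apply: H; exists j, i.
  have := congr1 (pihomog mdeg 0) es; rewrite raddf_sum /= pihomog_dE;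
    last exact: dhomog1.
  rewrite big1 => [/eqP|i _]; first by rewrite oner_eq0.
  by rewrite pihomogMC -/(s0 i) s00 mul0r.
by exists (B j); split=> //; exists i.
Qed.

Variables (a b : 'I_3 -> 'I_3 -> k) (c : k).
Local Notation s := (linear_forms a).
Local Notation s' := (linear_forms b).
Local Notation N := (linear_forms (transpose a)).
Local Notation N' := (linear_forms (transpose b)).
Hypothesis fE : forall i, f i = c *: cross s s' i.

Let cross_neq0 : ~ forall i, cross s s' i = 0.
Proof. by move=> H; have [i] := forms_neq0 F; rewrite fE H scaler0 eqxx. Qed.

Let f2 i : f i \is 2.-homog.
Proof. by rewrite fE; apply: dhomogZ; apply: (@cross_homog _ _ _ 1 1) => j;
  apply: linear_forms_homog. Qed.

Let sf : \sum_i s i * f i = 0.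
Proof.
under eq_bigr => i _ do rewrite fE -scalerAr.
by rewrite -scaler_sumr cross_orthl scaler0.
Qed.

Let s'f : \sum_i s' i * f i = 0.
Proof.
under eq_bigr => i _ do rewrite fE -scalerAr.
by rewrite -scaler_sumr cross_orthr scaler0.
Qed.

(** For a constant syzygy [e], the cross product of a column with [e] is a multiple of the forms;
    having degree 1 against their degree 2, it vanishes. Both columns are then parallel to [e], and
    their cross product is 0. *)
Lemma minors_free (e : 'I_3 -> k) : \sum_i e i *: f i = 0 -> forall i, e i = 0.
Proof.
move=> ef i; apply/eqP; apply: contrapT => /negP ei.
pose eC j : R := (e j)%:MP.
have eCf : \sum_j eC j * f j = 0.
  by rewrite -[RHS]ef; apply: eq_bigr => j _; rewrite mul_mpolyC.
have eC0 j : eC j \is 0.-homog.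
  by rewrite /eC -[_%:MP]mulr1 mul_mpolyC; apply: dhomogZ; apply: dhomog1.
have parallel u : (forall j, u j \is 1.-homog) -> \sum_j u j * f j = 0 ->
    forall m n, u m * eC n = u n * eC m.
  move=> u1 uf; apply: cross_eq0.
  have [t te] := coprime_multiple (forms_neq0 F) (forms_coprime codimF)
    (cross_proportional uf eCf).
  have [j fj] := forms_neq0 F => m.
  have [t0|t0] := eqVneq t 0; first by rewrite te t0 mul0r.
  have tf0 : t * f j != 0 by rewrite mulf_neq0.
  have h1 : t * f j \is 1.-homog by rewrite -te; apply: (@cross_homog _ _ _ 1 0).
  have m1 : mdeg (mlead (t * f j)) = 1%N := dhomog_mf h1 (mlead_supp tf0).
  have m2 : mdeg (mlead (f j)) = 2 := dhomog_mf (f2 j) (mlead_supp fj).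
  by move: m1; rewrite mleadM // mdegD m2 addnS addn1.
have p1 := parallel s (linear_forms_homog a) sf.
have p2 := parallel s' (linear_forms_homog b) s'f.
have eCi : eC i != 0 by rewrite mpolyC_eq0.
apply: cross_neq0 => n; apply: (mulIf (mulf_neq0 eCi eCi)); rewrite mul0r.
rewrite /cross; apply: (lincomb1 0 (erefl (0 : R))).
have r1 m := p1 m i; have r2 m := p2 m i.
transitivity ((s (n + 1) * eC i) * (s' (n + 1 + 1) * eC i) - (s (n + 1 + 1) *
  eC i) * (s' (n + 1) * eC i)).
  by ring.
by rewrite !r1 !r2; ring.
Qed.

Let G i := cross N N' i.

Let N1 := linear_forms_homog (transpose a).
Let N'1 := linear_forms_homog (transpose b).

(** If [N] and [N'] were proportional, either the same constants would relate the columns [s] and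
    [s'], whose minors would vanish, or [s] would be a constant vector times a linear form [l],
    which would divide all the forms. *)
Lemma dual_minors_neq0 : exists i, G i != 0.
Proof.
apply: contrapT => H.
have G0 i : G i = 0 by apply/eqP; apply: contrapT => /negP ?; apply: H; exists i.
have [[c1 [c2 [nz e]]]|[x [y [e [[i ei] xy]]]]] := proportional_linear_vectors
  N1 N'1 (cross_eq0 G0).
  have ss i : c1 *: s i = c2 *: s' i.
    rewrite /linear_forms !scaler_sumr; apply: eq_bigr => n _;
      rewrite !scalerA; congr (_ *: _).
    by have := congr1 (mcoeff U_(i)) (e n); rewrite !mcoeffZ !mcoeff_linear_forms.
  apply: cross_neq0 => i; case/orP: nz => nz; apply: (scalerI nz); rewrite scaler0.
    have -> : c1 *: cross s s' i = (c1 *: s (i + 1)) * s' (i + 1 + 1) - (c1 *: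
      s (i + 1 + 1)) * s' (i + 1).
      by rewrite /cross scalerBr !scalerAl.
    by rewrite !ss -!scalerAl -scalerBr [X in _ - X]mulrC subrr scaler0.
  have -> : c2 *: cross s s' i = s (i + 1) * (c2 *: s' (i + 1 + 1)) - s (i + 1
    + 1) * (c2 *: s' (i + 1)).
    by rewrite /cross scalerBr !scalerAr.
  by rewrite -!ss -!scalerAr -scalerBr [X in _ - X]mulrC subrr scaler0.
pose l : R := \sum_n e n *: 'X_n.
have se m : s m = x@_U_(m) *: l.
  rewrite /l scaler_sumr; apply: eq_bigr => n _; rewrite scalerA; congr (_ *: _).
  have [/(congr1 (mcoeff U_(m))) + _] := xy n;
    rewrite mcoeff_linear_forms /transpose => ->.
  by rewrite mulrC mcoeffCM mulrC.
have le : l@_U_(i) = e i by apply: (mcoeff_linear_forms (fun _ => e) 0 i).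
have l0 : l != 0 by apply: contraNneq ei => l0; rewrite -le l0 mcoeff0.
have lU : l \isn't a GRing.unit.
  apply/negP => /(@unitrP _) [l' [_ ll']].
  have l1 : l \is 1.-homog by apply: (linear_forms_homog (fun _ => e) 0).
  have l'0 : l' != 0 by apply: contra_eq_neq ll' => ->; rewrite mulr0 eq_sym oner_neq0.
  have := congr1 (fun p => mdeg (mlead p)) ll'; rewrite mleadM // mdegD mlead1 mdeg0.
  by have -> : mdeg (mlead l) = 1%N := dhomog_mf l1 (mlead_supp l0).
have [p pP pl] := prime_of_nonunit (@factorial_mpoly k 3) l0 lU.
apply: (forms_coprime codimF pP) => j; apply: divides_trans pl _.
exists (c *: (x@_U_(j + 1) *: s' (j + 1 + 1) - x@_U_(j + 1 + 1) *: s' (j + 1))).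
rewrite fE /cross !se -scalerAr mulrBr -!scalerAl -!scalerAr //.
Qed.

Lemma dual_minors_comp_neq0 : exists i, G i \mPo forms F != 0.
Proof.
apply: contrapT => H; have [i Gi] := dual_minors_neq0.
have Gf : G i \mPo forms F = 0 by apply/eqP; apply: contrapT => /negP ?;
  apply: H; exists i.
have G2 : G i \is 2.-homog := cross_homog N1 N'1 i.
have [e [[j ej] ef]] := unit_syzygy_dependent (form_relation_generic codimF
  lciF G2 Gf Gi).
by move: ej; rewrite (minors_free ef) eqxx.
Qed.

Lemma minors_cremona : is_cremona F.
Proof.
have G2 i : G i \is 2.-homog := cross_homog N1 N'1 i.
pose Gt := [tuple G i | i < 3].
have GtE i : tnth Gt i = G i by rewrite tnth_mktuple.
have Gh i : tnth Gt i \is 2.-homog by rewrite GtE.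
have Gn : exists i, tnth Gt i != 0.
  by have [i Gi] := dual_minors_neq0; exists i; rewrite GtE.
pose Gm := RationalMap Gh Gn.
have GF i j : (G i \mPo forms F) * 'X_j = (G j \mPo forms F) * 'X_i.
  rewrite !comp_cross; apply: (cross_proportional (f := fun i => 'X_i : R)).
    by rewrite bilinear_swap sf.
  by rewrite bilinear_swap s'f.
have NG : \sum_i N i * tnth Gt i = 0.
  by under eq_bigr => i _ do rewrite GtE; apply: cross_orthl.
have N'G : \sum_i N' i * tnth Gt i = 0.
  by under eq_bigr => i _ do rewrite GtE; apply: cross_orthr.
have FG i j : (f i \mPo Gt) * 'X_j = (f j \mPo Gt) * 'X_i.
  rewrite !fE !comp_mpolyZ !comp_cross -!scalerAl; congr (_ *: _).
  apply: (cross_proportional (f := fun i => 'X_i : R)).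
    by rewrite (bilinear_swap (transpose a)).
  by rewrite (bilinear_swap (transpose b)).
have [j hj] := dual_minors_comp_neq0.
exists Gm; split; split=> /=.
- by exists j; rewrite GtE.
- by move=> i i'; rewrite !GtE.
(* Since [X_j * G_m(f) = G_j(f) * X_m], degree 2 gives [X_j ^ 2 * f_i(G(f)) = G_j(f) ^ 2 * f_i],
   which is nonzero; so [f_i(G)] cannot vanish. *)
- have [i fi] := forms_neq0 F; exists i; apply/eqP => fG0.
  have fGF : (f i \mPo Gt) \mPo forms F = mmap (@mpolyC 3 k) (fun m => G m \mPo
    forms F) (f i).
    apply: (@mmap_morph _ _ _ _ (@mpolyC 3 k) (@mpolyC 3 k) (comp_mpoly (forms
      F))) => [x|m].
      exact: comp_mpolyC.
    by rewrite GtE.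
  have X : mmap (@mpolyC 3 k) (fun m => 'X_m) (f i) = f i.
    rewrite -[RHS]comp_mpoly_id /comp_mpoly /mmap; apply: eq_bigr => m _; congr (_ * _).
    by rewrite /mmap1; apply: eq_bigr => n _; rewrite tnth_mktuple.
  have : (G j \mPo forms F) ^+ 2 * f i != 0 by rewrite mulf_neq0 // expf_neq0.
  rewrite -{1}X -(mmap_homog _ _ _ (f2 i)) (_ : mmap _ _ _ = 'X_j ^+ 2 * mmap
    (@mpolyC 3 k) (fun m => G m \mPo forms F) (f i)).
    by rewrite -fGF fG0 rmorph0 mulr0 eqxx.
  rewrite -(mmap_homog _ _ _ (f2 i)) /mmap; apply: eq_bigr => m _; congr (_ * _).
  by rewrite /mmap1; apply: eq_bigr => n _; rewrite -GF mulrC.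
- exact: FG.
Qed.

End Backward.

Theorem corollary2p6 (k : fieldType) (F : rational_map k)
    (codimF : has_height (base_ideal F) 2)
    (lciF : locally_ci_at_minimal_primes (base_ideal F)) :
  is_cremona F <->
  exists M : 'M[{mpoly k[3]}]_(3, 2),
    (forall i j, M i j \is 1.-homog) /\ defined_by_minors F M.
Proof.
split=> [|[M [M1 [c c0 fE]]]]; first exact: cremona_minors.
pose col j i := middle_sign {mpoly k[3]} i * M i j.
have col1 j i : col j i \is 1.-homog.
  by rewrite /col /middle_sign; case: ifP => _; rewrite ?mulN1r ?dhomogN ?mul1r M1.
pose a j i n := (col j i)@_U_(n).
have colE j i : linear_forms (a j) i = col j i.
  by rewrite [RHS](linear_form_expand (col1 j i)).
have crossE i : cross (linear_forms (a 0)) (linear_forms (a 1)) i = - \det (row' i M).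
  by rewrite -cross_columns /cross !colE.
(* The constant is [- c] because the cross product of the signed columns is the opposite of the
   minors. *)
apply: (@minors_cremona _ _ codimF lciF (a 0) (a 1) (- c)) => i.
by rewrite crossE fE scaleNr scalerN opprK.
Qed.
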